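(* Assume that for some $\eta>0$, $\mathrm{supp}\,(\mu)\supset\{z\in\mathbb{R}^n:\ |z|\le\eta\}$. Let $u_0\in C(\Omega)$ be nonnegative, not identically zero and compactly supported in $\Omega$, and let $u\in C_b(\bar\Omega\times[0,\infty))$ be a solution of the Dirichlet problem with zero boundary data and initial data $u_0$, i.e. $\partial_t u=K_0(u)$ in $\Omega\times(0,\infty)$ and $u(\cdot,0)=u_0$ in $\Omega$. Then $$u(x,t)>0\quad\text{for all }(x,t)\in\bar\Omega\times(0,\infty).$$
   Context: $\Omega\subset\mathbb{R}^n$ is open, bounded, connected and regular (i.e. with smooth boundary). $\mu\in L^1(\mathbb{R}^n)$ is a nonnegative function with $\int_{\mathbb{R}^n}\mu(z)\,dz=1$; the symbol $\mu$ also denotes the measure $d\mu(z)=\mu(z)\,dz$, and $\mathrm{supp}\,(\mu)$ is its support as a measure. $C_b$ denotes bounded continuous functions. The nonlocal operator with zero boundary data is $$K_0(u)(x,t)=\int_{\{z:\,x+z\in\Omega\}}u(x+z,t)\,d\mu(z)-u(x,t),$$ and the equation $\partial_t u=K_0(u)$ is understood in the sense of distributions in $\Omega\times(0,\infty)$. *)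

(* Defs.v *)
From HB Require Import structures.
From mathcomp Require Import all_boot all_order all_algebra.
From mathcomp Require Import all_classical all_reals all_analysis.
From mathcomp Require Import measurable_realfun.

Set Implicit Arguments.
Unset Strict Implicit.
Unset Printing Implicit Defensive.

Import Order.TTheory GRing.Theory Num.Theory.
Import numFieldNormedType.Exports.

Local Open Scope classical_set_scope.
Local Open Scope ring_scope.

Section rV_measurable.
Context (R : realType) (n : nat).

Let coord (i : 'I_n) (v : 'rV[R]_n) : R := v 0 i.

Let rV0 : g_sigma_preimage coord set0.
Proof. exact: sigma_algebra0. Qed.

Let rVC A : g_sigma_preimage coord A -> g_sigma_preimage coord (~` A).
Proof. exact: sigma_algebraC. Qed.

Let rV_bigcup (F : (set 'rV[R]_n)^nat) :
  (forall i, g_sigma_preimage coord (F i)) ->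
  g_sigma_preimage coord (\bigcup_i (F i)).
Proof. exact: sigma_algebra_bigcup. Qed.

(* The Borel sigma-algebra of R^n, generated by the coordinate maps (these are
   continuous; conversely, see open_measurable_rV). *)
HB.instance Definition _ := @isMeasurable.Build default_measure_display
  'rV[R]_n (g_sigma_preimage coord) rV0 rVC rV_bigcup.

Lemma measurable_coord (i : 'I_n) :
  measurable_fun [set: 'rV[R]_n] (fun v : 'rV[R]_n => v 0 i).
Proof.
move=> _ Y mY; rewrite setTI; apply: sub_sigma_algebra => /=.
rewrite -bigcup_seq/=; exists i => /=; first by rewrite mem_index_enum.
by exists Y => //; rewrite setTI.
Qed.

End rV_measurable.


Section lebesgue_measure_rV.
Context (R : realType).

Definition cons_rV n (p : measurableTypeR R * 'rV[R]_n) : 'rV[R]_n.+1 :=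
  \row_i if unlift ord0 i is Some j then p.2 0 j else p.1.

Lemma cons_rVE0 n (p : measurableTypeR R * 'rV[R]_n) : cons_rV p 0 ord0 = p.1.
Proof. by rewrite mxE unlift_none. Qed.

Lemma cons_rVES n (p : measurableTypeR R * 'rV[R]_n) i :
  cons_rV p 0 (lift ord0 i) = p.2 0 i.
Proof. by rewrite mxE liftK. Qed.

Lemma measurable_rV d (T : measurableType d) n (f : T -> 'rV[R]_n) :
  (forall i, measurable_fun setT (fun x => f x 0 i)) ->
  measurable_fun setT f.
Proof.
move=> mf; apply: (@measurability _ _ _ _ setT f
  (\big[setU/set0]_(i < n)
    preimage_set_system setT (fun v : 'rV[R]_n => v 0 i) measurable)) => //.
move=> _ [C + <-]; rewrite -bigcup_seq/= => -[i _ [B mB <-{C}]].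
by rewrite !setTI -comp_preimage -[X in measurable X]setTI; exact: mf.
Qed.

Lemma measurable_cons_rV n : measurable_fun setT (@cons_rV n).
Proof.
apply: measurable_rV => i; case: (unliftP ord0 i) => [j ->|->].
  under eq_fun do rewrite cons_rVES.
  apply: (@measurableT_comp _ _ _ _ _ _ (fun v : 'rV[R]_n => v 0 j)) => //.
  exact: measurable_coord.
by under eq_fun do rewrite cons_rVE0; exact: measurable_fst.
Qed.

Section step.
Context n (m : {sigma_finite_measure set 'rV[R]_n -> \bar R}).

Definition lebesgue_rV_step : set 'rV[R]_n.+1 -> \bar R :=
  pushforward (@lebesgue_measure R \x m)%E (@cons_rV n).

Let lebesgue_rV_step0 : lebesgue_rV_step set0 = 0%E.
Proof. by rewrite /lebesgue_rV_step /pushforward preimage_set0 measure0. Qed.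

Let lebesgue_rV_step_ge0 A : (0 <= lebesgue_rV_step A)%E.
Proof. by rewrite /lebesgue_rV_step /pushforward; exact: measure_ge0. Qed.

Let lebesgue_rV_step_sigma_additive : semi_sigma_additive lebesgue_rV_step.
Proof.
move=> F mF tF mUF; rewrite /lebesgue_rV_step /pushforward preimage_bigcup.
apply: measure_semi_sigma_additive.
- by move=> i; rewrite -[X in measurable X]setTI; exact: measurable_cons_rV.
- apply/trivIsetP => /= i j _ _ ij; rewrite -preimage_setI.
  by move/trivIsetP : tF => /(_ _ _ _ _ ij) ->//; rewrite preimage_set0.
- rewrite -preimage_bigcup -[X in measurable X]setTI.
  exact: measurable_cons_rV.
Qed.

HB.instance Definition _ := isMeasure.Build _ _ _ lebesgue_rV_step
  lebesgue_rV_step0 lebesgue_rV_step_ge0 lebesgue_rV_step_sigma_additive.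

Let uncons (v : 'rV[R]_n.+1) : measurableTypeR R * 'rV[R]_n :=
  (v 0 ord0, \row_i v 0 (lift ord0 i)).

Let consK : cancel (@cons_rV n) uncons.
Proof.
move=> p; rewrite /uncons cons_rVE0 [RHS]surjective_pairing; congr pair.
by apply/rowP => i; rewrite mxE cons_rVES.
Qed.

Let measurable_uncons : measurable_fun setT uncons.
Proof.
apply: measurable_fun_pair; first exact: measurable_coord.
apply: measurable_rV => i; under eq_fun do rewrite mxE.
exact: measurable_coord.
Qed.

Let lebesgue_rV_step_sigma_finite : sigma_finite setT lebesgue_rV_step.
Proof.
have /sigma_finiteP[F [TF ndF Foo]] := sigma_finiteT (@lebesgue_measure R).
have /sigma_finiteP[G [TG ndG Goo]] := sigma_finiteT m.
exists (fun k => uncons @^-1` (F k `*` G k)).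
  rewrite -preimage_bigcup -[LHS](preimage_setT uncons); congr preimage.
  rewrite -setXTT TF TG predeqE => -[x y]; split.
    move=> [/= [a _ Fax] [b _ Gby]]; exists (maxn a b) => //; split.
    - by move: x Fax; exact/subsetPset/ndF/leq_maxl.
    - by move: y Gby; exact/subsetPset/ndG/leq_maxr.
  by move=> [a _ []/= ? ?]; split; exists a.
move=> k; have [mF Fk] := Foo k; have [mG Gk] := Goo k; split.
  rewrite -[X in measurable X]setTI.
  by apply: measurable_uncons => //; exact: measurableX.
rewrite /lebesgue_rV_step /pushforward -comp_preimage.
rewrite (_ : uncons \o _ = id); last by apply/funext => p /=; exact: consK.
by rewrite preimage_id product_measure1E// lte_mul_pinfty// ge0_fin_numE.
Qed.

HB.instance Definition _ := Measure_isSigmaFinite.Build _ _ _ lebesgue_rV_step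
  lebesgue_rV_step_sigma_finite.

End step.

(* Lebesgue measure on R^n, as an iterated product; it is characterized by
   lebesgue_rV_box. *)
Fixpoint lebesgue_rV n : {sigma_finite_measure set 'rV[R]_n -> \bar R} :=
  match n with
  | 0 => @dirac _ 'rV[R]_0 0 R
  | k.+1 => lebesgue_rV_step (lebesgue_rV k)
  end.

Lemma measurable_box n (A : 'I_n -> set R) : (forall i, measurable (A i)) ->
  measurable [set v : 'rV[R]_n | forall i, A i (v 0 i)].
Proof.
move=> mA; rewrite (_ : [set v | _] =
    \bigcap_(i in [set: 'I_n]) (fun v : 'rV[R]_n => v 0 i) @^-1` A i); last first.
  by apply/seteqP; split=> v /= vA i; [move=> _|]; exact: vA.
apply: fin_bigcap_measurable => // i _.
by rewrite -[X in measurable X]setTI; exact: measurable_coord.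
Qed.

Lemma lebesgue_rV_box n (A : 'I_n -> set R) : (forall i, measurable (A i)) ->
  lebesgue_rV n [set v | forall i, A i (v 0 i)] =
  (\prod_(i < n) @lebesgue_measure R (A i))%E.
Proof.
elim: n A => [|n IHn] A mA.
  by rewrite big_ord0 /= diracE mem_set// => -[].
rewrite big_ord_recl /= /lebesgue_rV_step /pushforward.
rewrite (_ : _ @^-1` _ =
    A ord0 `*` [set v : 'rV[R]_n | forall i, A (lift ord0 i) (v 0 i)]).
  rewrite product_measure1E.
  - by congr (_ * _)%E; exact: (IHn (fun i => A (lift ord0 i))).
  - exact: mA.
  - exact: (measurable_box (A := fun i => A (lift ord0 i))).
apply/seteqP; split=> -[x v] /=.
  move=> H; split; first by have := H ord0; rewrite cons_rVE0.
  by move=> i; have := H (lift ord0 i); rewrite cons_rVES.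
move=> [/= Ax Av] i; case: (unliftP ord0 i) => [j ->|->].
  by rewrite cons_rVES; exact: Av.
by rewrite cons_rVE0.
Qed.

Lemma open_measurable_rV n (U : set 'rV[R]_n) : open U -> measurable U.
Proof.
move=> oU.
pose I := ('rV[rat]_n * nat)%type.
pose B (q : I) := [set v : 'rV[R]_n | forall i,
   `|v 0 i - ratr (q.1 0 i)| < q.2.+1%:R^-1].
have mB q : measurable (B q).
  apply: (measurable_box (A := fun i => [set x | `|x - ratr (q.1 0 i)| < _])).
  move=> i; apply: open_measurable.
  rewrite (_ : [set x | _] = ball (ratr (q.1 0 i) : R) q.2.+1%:R^-1); last first.
    by apply/seteqP; split => x; rewrite /ball/= distrC.
  exact: ball_open.
rewrite (_ : U = \bigcup_(q in [set q | B q `<=` U]) B q).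
  rewrite bigcup_mkcond; apply: countable_bigcupT_measurable.
    exact: countableP.
  by move=> q; case: ifPn.
apply/seteqP; split=> [v Uv|v [q /= qU qv]]; last exact: qU.
have /nbhs_ballP[e /= e0 veU] : nbhs v U by exact: open_nbhs_nbhs.
have [k ke] : exists k : nat, k.+1%:R^-1 < e / 2 :> R.
  have [k kP] := ltr_add_invr (y := 0) (x := e / 2) (divr_gt0 e0 (ltr0n _ 2)).
  by exists k; rewrite add0r in kP.
have ratP i : exists q : rat, `|v 0 i - ratr q| < k.+1%:R^-1.
  have lt_i : v 0 i - k.+1%:R^-1 < v 0 i + k.+1%:R^-1.
    by rewrite ltrBlDr -addrA ltrDl addr_gt0// invr_gt0.
  have [q] := rat_in_itvoo lt_i; rewrite in_itv/= => /andP[q1 q2].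
  by exists q; rewrite distrC ltr_distl q1.
pose q : 'rV[rat]_n := \row_i projT1 (cid (ratP i)).
exists (q, k); last by move=> i /=; rewrite mxE; case: cid.
move=> w /= wB; apply: veU => /=.
split=> // i j; rewrite (ord1 i) /ball /=.
have vq : `|v 0 j - ratr (q 0 j)| < k.+1%:R^-1 by rewrite mxE; case: cid.
rewrite (le_lt_trans (ler_distD (ratr (q 0 j)) _ _))// [e]splitr ltrD//.
  exact: lt_trans vq ke.
by rewrite distrC; apply: lt_trans ke; exact: wB.
Qed.

End lebesgue_measure_rV.

(* `|v| on 'rV is the sup norm. *)
Definition euclid_norm (R : realType) n (v : 'rV[R]_n) : R :=
  Num.sqrt (\sum_i v 0 i ^+ 2).

(* Topological support of a set function, meant for Borel measures. *)
Definition measure_support (R : realType) (T : topologicalType)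
    (m : set T -> \bar R) : set T :=
  [set x | forall U, open U -> U x -> (0 < m U)%E].

(* The measure f(z) dz. *)
Definition density_measure (R : realType) n (f : 'rV[R]_n -> R) :
    set 'rV[R]_n -> \bar R :=
  fun A => (\int[lebesgue_rV R n]_(z in A) (f z)%:E)%E.

Section smooth.
Context (R : realType) (V : normedModType R).

Definition iter_derive (s : seq V) (f : V -> R) : V -> R :=
  foldr (fun v g => 'D_v g) f s.

(* C^oo on an open subset U of a finite-dimensional space V: all the iterated
   directional derivatives exist and are continuous on U. *)
Definition smooth_on (U : set V) (f : V -> R) : Prop :=
  forall s x, U x ->
    {for x, continuous (iter_derive s f)} /\
    forall v, derivable (iter_derive s f) x v.

Definition support_in (A : set V) (f : V -> R) : set V :=
  closure (A `&` [set x | f x != 0]).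

Definition compactly_supported_in (A : set V) (f : V -> R) : Prop :=
  compact (support_in A f) /\ support_in A f `<=` A.

(* C_c^oo(Q), whose elements are extended by 0 outside Q. *)
Definition test_function (Q : set V) (phi : V -> R) : Prop :=
  [/\ smooth_on setT phi, forall x, ~ Q x -> phi x = 0 &
      compactly_supported_in Q phi].

Definition bounded_continuous_on (A : set V) (f : V -> R) : Prop :=
  {within A, continuous f} /\ [bounded f x | x in A].

End smooth.

(* Near each of its boundary points, Omega is a strict sublevel set of a smooth
   function whose differential does not vanish at that point. *)
Definition smooth_boundary (R : realType) n (Omega : set 'rV[R]_n) : Prop :=
  forall x, (closure Omega `\` interior Omega) x ->
    exists (U : set 'rV[R]_n) (rho : 'rV[R]_n -> R),
      [/\ open U, U x, smooth_on U rho, exists v, 'D_v rho x != 0 &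
          Omega `&` U = [set y | rho y < 0] `&` U].

Section nonlocal_equation.
Context (R : realType) (n : nat).

Definition K0 (mu : 'rV[R]_n -> R) (Omega : set 'rV[R]_n)
    (u : 'rV[R]_n * R -> R) (p : 'rV[R]_n * R) : R :=
  (\int[lebesgue_rV R n]_(z in [set z | Omega (p.1 + z)])
      (u (p.1 + z, p.2) * mu z)) - u p.

(* du/dt = f in the sense of distributions in Q. *)
Definition dt_distr_eq (Q : set ('rV[R]_n * R)) (u f : 'rV[R]_n * R -> R) :
    Prop :=
  forall phi, test_function Q phi ->
    - (\int[(lebesgue_rV R n \x lebesgue_measure)%E]_(p in Q)
         (u p * 'D_(0, 1) phi p)) =
    (\int[(lebesgue_rV R n \x lebesgue_measure)%E]_(p in Q) (f p * phi p)).

End nonlocal_equation.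

(* Main.v *)
From HB Require Import structures.
Require Import Defs.
From mathcomp Require Import all_boot all_order all_algebra.
From mathcomp Require Import all_classical all_reals all_analysis.
From mathcomp Require Import measurable_realfun.
From mathcomp Require Import lra ring.

(** Write [J u (x, t)] for the integral of [u (x + z, t) mu z] over the [z] with
    [x + z] in [Omega], so that the equation reads du/dt = J u - u; formally
    d(e^t u)/dt = e^t J u, and [J] is monotone. Three consequences follow.

    - [u] is nonnegative in [Omega]. If [u >= - c e^t] then [J u >= - c e^t],
      hence d(e^t u)/dt >= - c e^(2t), and integrating from the nonnegative
      initial value gives [u >= - (c / 2) e^t]. Starting from the bound of [u]
      and halving for ever leaves [u >= 0] ([nonnegativity]).
    - [e^t u] is nondecreasing in time in [Omega]
      ([exp_solution_nondecreasing]), since [J u >= 0]. So a point where [u0] is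
      positive stays positive for ever.
    - Positivity propagates at once to every [x] of [closure Omega] such that
      [x0 - x] is in the support of [mu], where [x0] is a point at which [u] is
      positive at all positive times ([positivity_spreads]): [u] is bounded
      below near [x0], and the mass that [mu] puts near [x0 - x] makes
      d(e^t u)/dt bounded below by a positive constant, uniformly near [x].

    As the support of [mu] contains a ball, the set of the points of [Omega] at
    which [u] is positive at all positive times is open and closed in [Omega];
    it is nonempty, so it is [Omega] by connectedness. A last propagation step
    reaches the boundary points.

    The equation holds only in the sense of distributions, so all three facts go
    through one comparison principle, [duhamel_monotone]: if e^t J u >= P'(t) on
    an open set [W] after time [a0], then [e^t u - P] is nondecreasing there. If
    it decreased at [x] between the times [s] and [t], then, up to a constant
    absorbed in [P], it would be positive near [(x, s)] and negative near
    [(x, t)]. Test the equation with psi(y) e^z theta(z), where [psi] is a bump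
    at [x] and theta >= 0 rises from 0 to a constant just after [s] and falls
    back just after [t]: the integral of [(e^t u - P) psi theta'] is then at once
    nonpositive and positive.

    What remains is to build smooth compactly supported functions out of
    exp(- 1 / x), and to prove the joint measurability that the integrals over
    the product require. *)

Set Implicit Arguments.
Unset Strict Implicit.
Unset Printing Implicit Defensive.

Import Order.TTheory GRing.Theory Num.Theory.
Import numFieldNormedType.Exports.

Local Open Scope classical_set_scope.
Local Open Scope ring_scope.

(** * A flat function *)

Section flat.
Context {R : realType}.
Implicit Types x : R.

(** The derivatives of exp(- 1 / x), extended by 0 to x <= 0, are combinations of
    these functions; the exponent [k] makes the family stable under derivation. *)
Definition flat k x : R := if 0 < x then x^-1 ^+ k * expR (- x^-1) else 0.

Lemma flat_le0 k x : x <= 0 -> flat k x = 0.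
Proof. by rewrite /flat ltNge => ->. Qed.

Lemma flat_gt0 k x : 0 < x -> 0 < flat k x.
Proof.
by move=> x0; rewrite /flat x0 mulr_gt0 ?expR_gt0// exprn_gt0// invr_gt0.
Qed.

Lemma flat_ge0 k x : 0 <= flat k x.
Proof. by case: (ltP 0 x) => [/flat_gt0/ltW|/flat_le0 ->]. Qed.

(** The exponential series gives s^(k+2) <= (k+2)! e^s; with s = 1 / x this is a
    quadratic bound at 0, which is what differentiability at 0 needs. *)
Lemma flat_bound k x : flat k x <= (k.+2)`!%:R * x ^+ 2.
Proof.
case: (ltP 0 x) => [x0|/flat_le0 ->]; last by rewrite mulr_ge0// sqr_ge0.
rewrite /flat x0 expRN ler_pdivrMr ?expR_gt0// -mulrA.
have := expR_ge1Dxn k.+1 (ltW (_ : 0 < x^-1)).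
rewrite invr_gt0 => /(_ x0) E.
have H : x^-1 ^+ k.+2 / k.+2`!%:R <= expR x^-1 by apply: le_trans E; rewrite lerDr.
have F0 : 0 < (k.+2`!%:R : R) by rewrite ltr0n fact_gt0.
rewrite -ler_pdivrMl -?ler_pdivrMl ?exprn_gt0//.
apply: le_trans H; rewrite le_eqVlt; apply/orP; left; apply/eqP.
by rewrite -exprVn !exprS; ring.
Qed.

Lemma is_derive_flat k x :
  is_derive x 1 (flat k) (flat k.+2 x - k%:R * flat k.+1 x).
Proof.
have [x0|x0|->] := ltgtP x 0.
- rewrite !flat_le0 ?(ltW x0)// mulr0 subrr.
  apply: (@near_eq_is_derive _ _ _ (cst 0)).
  near=> y; rewrite flat_le0// ltW//; near: y; exact: lt_nbhsl.
- apply: (@near_eq_is_derive _ _ _ (fun y : R => y^-1 ^+ k * expR (- y^-1) : R^o)).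
    near=> y; rewrite /flat ifT//; near: y; exact: lt_nbhsr.
  rewrite /flat x0.
  have x_neq0 : x != 0 by rewrite gt_eqF.
  have dV : is_derive x 1 (fun y : R => y^-1) (- x ^- 2 *: 1) by exact: is_deriveV.
  have dE : is_derive x 1 (fun y : R => expR (- y^-1))
     (expR (- x^-1) * - (- x ^- 2 *: 1)) by apply: is_derive1_comp.
  have := is_deriveM (is_deriveX k dV) dE; rewrite !fctE => dM.
  apply: (is_derive_eq dM).
  rewrite /GRing.scale /=; case: (k) => [|m].
    by rewrite !mulr0n !expr0; field.
  by rewrite -mulr_natl /= !exprVn !exprS; field; rewrite expf_neq0.
- rewrite !flat_le0// mulr0 subrr.
  have H : h^-1 *: ((flat k \o shift (0 : R)) (h *: 1) - flat k 0)
      @[h --> (0 : R)^'] --> (0 : R).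
    apply/cvgrPdist_le => e e0; near=> h.
    rewrite sub0r normrN /= (flat_le0 k (lexx 0)) subr0 addr0 /GRing.scale/= mulr1.
    have h0 : `|h| != 0 by rewrite normr_eq0; near: h; exact: nbhs_dnbhs_neq.
    rewrite normrM normfV (ger0_norm (flat_ge0 _ _)) ler_pdivrMl ?lt0r ?h0 ?normr_ge0//.
    rewrite (le_trans (flat_bound _ _))// -real_normK ?num_real//.
    rewrite expr2 mulrCA ler_pM2l ?lt0r ?h0 ?normr_ge0//.
    rewrite -ler_pdivlMl ?ltr0n ?fact_gt0//.
    near: h; apply: dnbhs0_le.
    by rewrite mulr_gt0// invr_gt0 ltr0n fact_gt0.
  apply: DeriveDef; first by apply/cvg_ex; exists 0.
  exact/cvg_lim.
Unshelve. all: by end_near. Qed.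

End flat.

(** * A smooth step *)

Section bump.
Context {R : realType}.
Implicit Types x y : R.
Notation mu := (@lebesgue_measure R).

Lemma continuous_flat k : continuous (@flat R k).
Proof.
move=> x; apply: differentiable_continuous; apply/derivable1_diffP.
by have [] := is_derive_flat k x.
Qed.

Definition unit_bump x : R := flat 0 x * flat 0 (1 - x).

Lemma unit_bump_ge0 x : 0 <= unit_bump x.
Proof. by rewrite mulr_ge0// flat_ge0. Qed.

Lemma unit_bump_gt0 x : 0 < x -> x < 1 -> 0 < unit_bump x.
Proof. by move=> x0 x1; rewrite mulr_gt0// flat_gt0// subr_gt0. Qed.

Lemma unit_bump_le0 x : x <= 0 -> unit_bump x = 0.
Proof. by move=> x0; rewrite /unit_bump flat_le0// mul0r. Qed.

Lemma unit_bump_ge1 x : 1 <= x -> unit_bump x = 0.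
Proof. by move=> x1; rewrite /unit_bump mulrC flat_le0 ?mul0r// subr_le0. Qed.

Lemma continuous_unit_bump : continuous unit_bump.
Proof.
move=> x; apply: cvgM; first exact: continuous_flat.
apply: (continuous_comp (f := fun y => 1 - y)); last exact: continuous_flat.
by apply: continuousB; [exact: cvg_cst|exact: cvg_id].
Qed.

Lemma integrable_unit_bump : mu.-integrable setT (EFin \o unit_bump).
Proof.
rewrite (_ : EFin \o unit_bump = (EFin \o unit_bump) \_ `[0, 1]); last first.
  apply/funext => x; rewrite patchE; case: ifPn => //.
  rewrite notin_setE/= in_itv/= => /negP; rewrite negb_and -!ltNge.
  by case/orP => [/ltW/unit_bump_le0|/ltW/unit_bump_ge1] /= ->.
apply/(integrable_mkcond _ _).1; first exact: measurable_itv.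
apply: continuous_compact_integrable; first exact: segment_compact.
by apply: continuous_subspaceT => x; exact: continuous_unit_bump.
Qed.

(** A smooth substitute for the Heaviside function, up to the constant [step 1]:
    zero on x <= 0 and constant on x >= 1. *)
Definition step x : R := \int[mu]_(t in `]-oo, x]) unit_bump t.

Lemma is_derive_step x : is_derive x 1 step (unit_bump x).
Proof.
have [||||dF FE] := @continuous_FTC1 R unit_bump -oo%O x (x + 1).
- by rewrite ltrDl.
- exact: integrableS integrable_unit_bump.
- by rewrite ltNyr.
- exact: continuous_unit_bump.
- by apply: DeriveDef => //; rewrite -derive1E.
Qed.

Lemma continuous_step : continuous step.
Proof.
move=> x; apply: differentiable_continuous; apply/derivable1_diffP.
by have [] := is_derive_step x.
Qed.

Lemma step_le0 x : x <= 0 -> step x = 0.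
Proof.
move=> x0; rewrite /step (_ : 0 = \int[mu]_(t in `]-oo, x]) (cst 0 t)).
  apply: eq_Rintegral => y; rewrite inE/= in_itv/= => yx.
  by rewrite unit_bump_le0// (le_trans yx).
by rewrite Rintegral_cst// mul0r.
Qed.

Lemma step_increment x y : x < y ->
  exists2 c, x < c < y & step y - step x = unit_bump c * (y - x).
Proof.
move=> xy.
have [|c] := @MVT R step unit_bump x y xy (fun z _ => is_derive_step z).
  by apply: continuous_subspaceT; exact: continuous_step.
by rewrite in_itv => cxy H; exists c.
Qed.

Lemma step_nondecreasing x y : x <= y -> step x <= step y.
Proof.
rewrite le_eqVlt => /predU1P[->//|xy]; have [c _ E] := step_increment xy.
by rewrite -subr_ge0 E mulr_ge0 ?unit_bump_ge0// subr_ge0 ltW.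
Qed.

Lemma step_ge1 x : 1 <= x -> step x = step 1.
Proof.
rewrite le_eqVlt => /predU1P[->//|x1]; have [c /andP[c1 _] E] := step_increment x1.
by apply/eqP; rewrite -subr_eq0 E unit_bump_ge1 ?mul0r// ltW.
Qed.

End bump.

(** * A class of smooth functions stable under derivation *)

Section elementary.
Context {R : realType} {V : normedModType R}.
Implicit Types f g : V -> R.

Lemma differentiable_comp_real (g : R -> R) dg f x :
  differentiable f x -> is_derive (f x) 1 g dg -> differentiable (g \o f) x.
Proof.
by move=> df [dgx _]; apply: differentiable_comp => //; exact/derivable1_diffP.
Qed.

Lemma derive_comp_real (g : R -> R) dg f x v :
  differentiable f x -> is_derive (f x) 1 g dg ->
  'D_v (g \o f) x = dg * 'D_v f x.
Proof.
move=> df dgx; have dgf := differentiable_comp_real df dgx.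
have [/derivable1_diffP dg' <-] := dgx.
rewrite deriveE// diff_comp//= deriveE// deriveE//.
by rewrite -[X in 'd g _ X](mulr1 ('d f x v)) -[_ * 1]/(_ *: _) linearZ/= mulrC.
Qed.

(** Instead of computing iterated derivatives, smoothness is read off from a class
    of differentiable functions that is stable under directional derivatives. The
    generators are closed under derivation: [flat k] leads to [flat k.+1] and
    [flat k.+2], [step] to a product of two [flat 0], and [expR] to itself. *)
Inductive elementary : (V -> R) -> Prop :=
| elementary_cst c : elementary (cst c)
| elementary_linear (L : {linear V -> R^o}) : continuous L -> elementary L
| elementaryD f g : elementary f -> elementary g ->
    elementary (fun x => f x + g x)
| elementaryM f g : elementary f -> elementary g ->
    elementary (fun x => f x * g x)
| elementary_flat k f : elementary f -> elementary (flat k \o f)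
| elementary_step f : elementary f -> elementary (step \o f)
| elementary_expR f : elementary f -> elementary (expR \o f).

Lemma elementary_differentiable f x : elementary f -> differentiable f x.
Proof.
elim=> {f} [c|L cL|f g _ df _ dg|f g _ df _ dg|k f _ df|f _ df|f _ df].
- exact: differentiable_cst.
- exact: linear_differentiable.
- exact: differentiableD.
- exact: differentiableM.
- exact: differentiable_comp_real (is_derive_flat k (f x)).
- exact: differentiable_comp_real (is_derive_step (f x)).
- exact: differentiable_comp_real (is_derive_expR (f x)).
Qed.

Lemma elementary_derive f v : elementary f -> elementary ('D_v f).
Proof.
have dE := elementary_differentiable.
have dv g x : elementary g -> derivable g x v.
  by move=> eg; apply/diff_derivable/dE.
elim=> {f} [c|L cL|f g ef Df eg Dg|f g ef Df eg Dg|k f ef Df|f ef Df|f ef Df].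
- rewrite (_ : 'D_v _ = cst 0); first exact: elementary_cst.
  by apply/funext => x; rewrite derive_cst.
- rewrite (_ : 'D_v _ = cst (L v)); first exact: elementary_cst.
  apply/funext => x; rewrite deriveE; last exact: linear_differentiable.
  by rewrite diff_lin.
- rewrite (_ : 'D_v _ = fun x => 'D_v f x + 'D_v g x); first exact: elementaryD.
  by apply/funext => x; rewrite deriveD//; exact: dv.
- rewrite (_ : 'D_v _ = fun x => f x * 'D_v g x + g x * 'D_v f x).
    by apply: elementaryD; exact: elementaryM.
  by apply/funext => x; rewrite deriveM//; exact: dv.
- rewrite (_ : 'D_v _ = fun x => (flat k.+2 (f x) +
      cst (- k%:R) x * flat k.+1 (f x)) * 'D_v f x).
    apply: elementaryM => //; apply: elementaryD; first exact: elementary_flat.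
    by apply: elementaryM; [exact: elementary_cst|exact: elementary_flat].
  apply/funext => x; rewrite (derive_comp_real _ (dE _ x ef)
    (is_derive_flat k (f x))).
  by rewrite mulNr.
- rewrite (_ : 'D_v _ = fun x => (flat 0 (f x) *
      flat 0 (cst 1 x + cst (-1) x * f x)) * 'D_v f x).
    apply: elementaryM => //; apply: elementaryM; first exact: elementary_flat.
    apply: (@elementary_flat _ (fun x => cst 1 x + cst (-1) x * f x)).
    apply: elementaryD; first exact: elementary_cst.
    by apply: elementaryM => //; exact: elementary_cst.
  apply/funext => x; rewrite (derive_comp_real _ (dE _ x ef)
    (is_derive_step (f x))).
  by rewrite /unit_bump /= mulN1r.
- rewrite (_ : 'D_v _ = fun x => expR (f x) * 'D_v f x).
    by apply: elementaryM => //; exact: elementary_expR.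
  apply/funext => x; exact: (derive_comp_real _ (dE _ x ef)
    (is_derive_expR (f x))).
Qed.

Lemma elementary_iter_derive f s : elementary f -> elementary (iter_derive s f).
Proof. by move=> ef; elim: s => //= v s; exact: elementary_derive. Qed.

Lemma elementary_smooth f : elementary f -> smooth_on setT f.
Proof.
move=> ef s x _; have ds := elementary_differentiable x (elementary_iter_derive s ef).
split; first exact: differentiable_continuous.
by move=> v; exact: diff_derivable.
Qed.

Lemma elementary_continuous f : elementary f -> continuous f.
Proof.
by move=> ef x; apply: differentiable_continuous; exact: elementary_differentiable.
Qed.

Lemma elementaryZ c f : elementary f -> elementary (fun x => c * f x).
Proof. by move=> ef; apply: (@elementaryM (cst c)) => //; exact: elementary_cst. Qed.

Lemma elementary_affine c d f : elementary f -> elementary (fun x => c * f x + d).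
Proof.
move=> ef; apply: (@elementaryD _ (cst d)); first exact: elementaryZ.
exact: elementary_cst.
Qed.

Lemma elementary_bump f : elementary f -> elementary (unit_bump \o f).
Proof.
move=> ef; apply: (@elementaryM (flat 0 \o f) (fun x => flat 0 (1 - f x))).
  exact: elementary_flat.
rewrite (_ : (fun x => _) = flat 0 \o (fun x => -1 * f x + 1 : R)%R).
  by apply: elementary_flat; exact: elementary_affine.
by apply/funext => x /=; rewrite mulN1r addrC.
Qed.

Lemma elementary_prod (I : Type) (r : seq I) (F : I -> V -> R) :
  (forall i, elementary (F i)) -> elementary (fun x => \prod_(i <- r) F i x).
Proof.
move=> eF; elim: r => [|i r IH].
  rewrite (_ : (fun x => _) = cst 1); first exact: elementary_cst.
  by apply/funext => x; rewrite big_nil.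
rewrite (_ : (fun x => _) = fun x => F i x * \prod_(j <- r) F j x).
  exact: elementaryM.
by apply/funext => x; rewrite big_cons.
Qed.

End elementary.

(** * Borel sets of space-time *)

Section borel.
Context {R : realType} {n : nat}.
Notation X := 'rV[R]_n.
Notation T := (X * measurableTypeR R)%type.
Notation leb := (lebesgue_rV R n \x @lebesgue_measure R)%E.

Lemma rV_ballP m (x y : 'rV[R]_m) r : 0 < r ->
  ball x r y <-> forall j, `|x 0 j - y 0 j| < r.
Proof.
move=> r0; split=> [[_ H] j|H]; first exact: H.
by split=> // i j; rewrite (ord1 i); exact: H.
Qed.

(* R^n x R is identified with R^(n+1), where open sets are known to be Borel. *)
Let split_rV (v : 'rV[R]_n.+1) : X * R := (\row_i v 0 (lift ord0 i), v 0 ord0).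

Let continuous_split_rV : continuous split_rV.
Proof.
move=> v; apply: (iffRL (@cvg_ballP _ _ _ (nbhs v) _ split_rV (split_rV v))) => e e0; near=> w.
have /(rV_ballP _ _ e0) vw : ball v e w by near: w; exact: nbhsx_ballx.
by split; [apply/rV_ballP => // j; rewrite !mxE|]; exact: vw.
Unshelve. all: by end_near. Qed.

Lemma open_measurable_rV_prod (U : set T) : open (U : set (X * R)) -> measurable U.
Proof.
move=> oU.
pose c (p : T) := cons_rV (p.2, p.1).
have cK p : split_rV (c p) = p.
  rewrite [RHS]surjective_pairing /split_rV cons_rVE0; congr pair.
  by apply/rowP => j; rewrite mxE cons_rVES.
rewrite (_ : U = c @^-1` (split_rV @^-1` U)); last first.
  by apply/seteqP; split=> p /=; rewrite cK.
rewrite -[X in measurable X]setTI.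
have mc : measurable_fun setT c.
  by apply: (measurableT_comp (@measurable_cons_rV R n)); exact: measurable_swap.
apply: mc => //; apply: open_measurable_rV.
by move/continuousP : continuous_split_rV; apply.
Qed.

(** Continuity within [A] in epsilon-delta form, in which [A] need not be a
    neighbourhood of [p]: this is how values at time 0 and at boundary points are
    compared with values inside the domain. *)
Lemma within_continuousP (V : normedModType R) (A : set V) (f : V -> R) p e :
  {within A, continuous f} -> A p -> 0 < e ->
  exists2 d : R, 0 < d & forall q, A q -> ball p d q -> `|f p - f q| < e.
Proof.
move=> cf Ap e0; have /cvgrPdist_lt/(_ _ e0) := cf p.
rewrite /prop_near1; case: (@nbhs_subspaceP _ A p) => // _.
move=> /nbhs_ballP[d /= d0 H].
by exists d => // q Aq dq; exact: H.
Qed.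

Lemma within_continuous_measurable (A Q : set T) (f : T -> R) :
  {within (A : set (X * R)), continuous (f : X * R -> R)} -> open (Q : set (X * R)) ->
  Q `<=` A -> measurable_fun Q f.
Proof.
move=> cf oQ QA mQ; apply: (measurability _ (RGenOInfty.measurableE R)) => //.
move=> /= _ [_ [a ->] <-]; apply: open_measurable_rV_prod.
rewrite openE => p [Qp /=]; rewrite in_itv/= andbT => ap.
have e0 : 0 < f p - a by rewrite subr_gt0.
have [d /= d0 H] := within_continuousP cf (QA _ Qp) e0.
have : nbhs (p : X * R) (Q `&` ball (p : X * R) d).
  by apply: filterI; [exact: open_nbhs_nbhs|exact: nbhsx_ballx].
apply: filterS => q [Qq pq]; split=> //=; rewrite in_itv/= andbT.
have := H q (QA _ Qq) pq; rewrite ltr_norml => /andP[_]; lra.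
Qed.

Lemma continuous_measurable_prod (f : T -> R) :
  continuous (f : X * R -> R) -> measurable_fun setT f.
Proof.
move=> cf; apply: (@within_continuous_measurable setT) => //.
  exact: continuous_subspaceT.
exact: openT.
Qed.

Lemma measurable_ball_rV (x : X) r : measurable (ball x r).
Proof. by apply: open_measurable_rV; exact: ball_open. Qed.

Lemma lebesgue_rV_ball_gt0 (x : X) r : 0 < r -> (0 < lebesgue_rV R n (ball x r))%E.
Proof.
move=> r0.
rewrite (_ : ball x r = [set v | forall i, `]x 0 i - r, x 0 i + r[%classic (v 0 i)]).
  rewrite (@lebesgue_rV_box _ _ (fun i => `]x 0 i - r, x 0 i + r[%classic))//.
  apply: (big_ind (fun z : \bar R => 0 < z)%E) => // [z w|i _].
    exact: mule_gt0.
  rewrite lebesgue_measure_itv/= lte_fin ifT; last by lra.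
  by rewrite -EFinB lte_fin; lra.
apply/seteqP; split=> v.
  by move/(rV_ballP _ _ r0) => H i /=; rewrite in_itv/= -ltr_distlC.
by move=> H; apply/(rV_ballP _ _ r0) => i; have := H i; rewrite /= in_itv/= -ltr_distlC.
Qed.

Lemma leb_box_gt0 (x : X) r (a b : R) : 0 < r -> a < b ->
  (0 < leb (ball x r `*` `]a, b[))%E.
Proof.
move=> r0 ab; rewrite product_measure1E//; last exact: measurable_ball_rV.
apply: mule_gt0; first exact: lebesgue_rV_ball_gt0.
have : (0 < @lebesgue_measure R `]a, b[)%E; last by [].
by rewrite lebesgue_measure_itv/= lte_fin ab -EFinB lte_fin subr_gt0.
Qed.

End borel.

(** * Cutoffs in space and windows in time *)

Section cutoff.
Context {R : realType} {n : nat}.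
Notation X := 'rV[R]_n.
Implicit Types (x y : X) (r a b e t : R).

(** Positive exactly on the open cube of centre [x] and half-side [r], which is the
    ball of the sup norm. *)
Definition cutoff x r y : R :=
  \prod_i unit_bump ((2 * r)^-1 * (y 0 i - x 0 i) + 2^-1).

Lemma cutoff_ge0 x r y : 0 <= cutoff x r y.
Proof. by apply: prodr_ge0 => i _; exact: unit_bump_ge0. Qed.

Lemma cutoff_gt0 x r y : 0 < r -> ball x r y -> 0 < cutoff x r y.
Proof.
move=> r0 /(rV_ballP _ _ r0) xy; apply: prodr_gt0 => i _.
have := xy i; rewrite ltr_distlC => /andP[xy1 xy2].
apply: unit_bump_gt0.
  rewrite -ltrBlDr sub0r ltr_pdivlMl ?mulr_gt0//.
  by rewrite mulrN mulrAC divff//; lra.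
by rewrite -ltrBrDr ltr_pdivrMl ?mulr_gt0//; lra.
Qed.

Lemma cutoff_neq0 x r y : 0 < r -> cutoff x r y != 0 ->
  forall i, x 0 i - r <= y 0 i <= x 0 i + r.
Proof.
move=> r0 xy i; apply: contraNT xy.
have r2 : 0 < 2 * r by rewrite mulr_gt0.
rewrite negb_and -!ltNge /cutoff (bigD1 i)//= => /orP[yi|yi].
  rewrite unit_bump_le0 ?mul0r// -lerBrDr sub0r ler_pdivrMl//; lra.
rewrite unit_bump_ge1 ?mul0r// -lerBlDr ler_pdivlMl//; lra.
Qed.

(** For 0 < e <= b - a, rises on [a, a + e], is constant on [a + e, b] and falls on
    [b, b + e]. The derivative [dwindow] is thus a positive bump after [a] minus a
    translate of it after [b]: integrating against it compares values at the times
    [a] and [b]. *)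
Definition window a b e (t : R) : R :=
  step (e^-1 * (t - a)) - step (e^-1 * (t - b)).

Definition dwindow a b e (t : R) : R :=
  e^-1 * (unit_bump (e^-1 * (t - a)) - unit_bump (e^-1 * (t - b))).

Lemma window_ge0 a b e t : 0 < e -> a <= b -> 0 <= window a b e t.
Proof.
move=> e0 ab; rewrite subr_ge0 step_nondecreasing// ler_pM2l ?invr_gt0//; lra.
Qed.

Lemma window_le a b e t : 0 < e -> a <= b -> t <= a -> window a b e t = 0.
Proof.
move=> e0 ab ta; rewrite /window !step_le0 ?subrr// pmulr_rle0 ?invr_gt0//; lra.
Qed.

Lemma window_ge a b e t : 0 < e -> a <= b -> b + e <= t -> window a b e t = 0.
Proof.
move=> e0 ab ta; rewrite /window [in LHS]step_ge1 ?[in X in _ - X]step_ge1 ?subrr//;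
  by rewrite ler_pdivlMl//; lra.
Qed.

Lemma is_derive_window a b e t : is_derive t 1 (window a b e) (dwindow a b e t).
Proof.
have H c : is_derive t 1 (fun t => step (e^-1 * (t - c)))
    (unit_bump (e^-1 * (t - c)) * e^-1).
  have dl : is_derive t 1 (fun t : R => e^-1 * (t - c)) e^-1.
    have := is_deriveZ e^-1 (is_deriveB (@is_derive_id R R^o t 1)
      (@is_derive_cst R R^o R^o c t 1)).
    by rewrite subr0 /GRing.scale/= mulr1.
  by apply: (is_derive1_comp (f := step)); exact: is_derive_step.
by apply: (is_derive_eq (is_deriveB (H a) (H b))); rewrite /dwindow -mulrBl mulrC.
Qed.

Lemma continuous_dwindow a b e : continuous (dwindow a b e).
Proof.
have H c : continuous (fun t => unit_bump (e^-1 * (t - c))).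
  move=> t; apply: (continuous_comp (f := fun t => e^-1 * (t - c))).
    by apply: cvgM; [exact: cvg_cst|apply: cvgB; [exact: cvg_id|exact: cvg_cst]].
  exact: continuous_unit_bump.
by move=> t; apply: cvgM; [exact: cvg_cst|apply: cvgB; exact: H].
Qed.

Lemma dwindow_gt0 a b e t : 0 < e -> a + e <= b -> a < t -> t < a + e ->
  0 < dwindow a b e t.
Proof.
move=> e0 ab at1 ta; rewrite mulr_gt0 ?invr_gt0//.
rewrite (@unit_bump_le0 _ (e^-1 * (t - b))) ?subr0; last first.
  by rewrite pmulr_rle0 ?invr_gt0//; lra.
apply: unit_bump_gt0; first by rewrite mulr_gt0 ?invr_gt0//; lra.
by rewrite ltr_pdivrMl//; lra.
Qed.

Lemma dwindow_ge0 a b e t : 0 < e -> t <= b -> 0 <= dwindow a b e t.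
Proof.
move=> e0 tb; rewrite mulr_ge0 ?invr_ge0 ?(ltW e0)//.
rewrite (@unit_bump_le0 _ (e^-1 * (t - b))) ?subr0 ?unit_bump_ge0//.
by rewrite pmulr_rle0 ?invr_gt0//; lra.
Qed.

Lemma dwindow_le0 a b e t : 0 < e -> a + e <= t -> dwindow a b e t <= 0.
Proof.
move=> e0 tb; rewrite pmulr_rle0 ?invr_gt0// (@unit_bump_ge1 _ (e^-1 * (t - a))).
  by rewrite sub0r oppr_le0 unit_bump_ge0.
by rewrite ler_pdivlMl//; lra.
Qed.

Lemma dwindow_eq0 a b e t : 0 < e -> a <= b ->
  t \notin `[a, b + e] -> dwindow a b e t = 0.
Proof.
move=> e0 ab; rewrite in_itv/= negb_and -!ltNge => /orP[ta|bt].
  rewrite /dwindow (@unit_bump_le0 _ (e^-1 * (t - a))); last first.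
    by rewrite pmulr_rle0 ?invr_gt0//; lra.
  rewrite (@unit_bump_le0 _ (e^-1 * (t - b))) ?subrr ?mulr0//.
  by rewrite pmulr_rle0 ?invr_gt0//; lra.
rewrite /dwindow (@unit_bump_ge1 _ (e^-1 * (t - a))); last first.
  by rewrite ler_pdivlMl//; lra.
rewrite (@unit_bump_ge1 _ (e^-1 * (t - b))) ?subrr ?mulr0//.
by rewrite ler_pdivlMl//; lra.
Qed.

End cutoff.

(** * Test functions *)

Section test_functions.
Context {R : realType} {n : nat}.
Notation X := 'rV[R]_n.
Notation T := (X * measurableTypeR R)%type.
Notation leb := (lebesgue_rV R n \x @lebesgue_measure R)%E.
Implicit Types (x y : X) (r a b e t : R).

Definition cylinder x r a b : set T :=
  [set v : X | forall i, `[x 0 i - r, x 0 i + r]%classic (v 0 i)] `*` `[a, b].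

Lemma compact_cylinder x r a b : compact (cylinder x r a b : set (X * R)).
Proof.
apply: compact_setX; last exact: segment_compact.
by apply: (@rV_compact _ _ (fun i => `[x 0 i - r, x 0 i + r]%classic)) => i;
  exact: segment_compact.
Qed.

Lemma closed_cylinder x r a b : closed (cylinder x r a b : set (X * R)).
Proof. by apply: compact_closed; [exact: norm_hausdorff|exact: compact_cylinder]. Qed.

Lemma measurable_cylinder x r a b : measurable (cylinder x r a b).
Proof.
apply: measurableX; last exact: measurable_itv.
exact: (measurable_box (A := fun i => `[x 0 i - r, x 0 i + r]%classic)).
Qed.

Lemma leb_cylinder_lty x r a b : (leb (cylinder x r a b) < +oo)%E.
Proof.
rewrite product_measure1E; last 2 first.
- exact: (measurable_box (A := fun i => `[x 0 i - r, x 0 i + r]%classic)).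
- exact: measurable_itv.
have fin_itv (c d : R) : @lebesgue_measure R `[c, d] \is a fin_num.
  by rewrite lebesgue_measure_itv/=; case: ifPn.
pose B := [set v : X | forall i, `[x 0 i - r, x 0 i + r]%classic (v 0 i)].
suff : (lebesgue_rV R n B * @lebesgue_measure R `[a, b] < +oo)%E by [].
rewrite (@lebesgue_rV_box _ _ (fun i => `[x 0 i - r, x 0 i + r]%classic))//.
rewrite ltey_eq fin_numM ?fin_itv//.
by apply: (big_ind (fun z : \bar R => z \is a fin_num)) => // z w; exact: fin_numM.
Qed.

Lemma elementary_linear_fun (V : normedModType R) (f : V -> R) :
  linear (f : V -> R^o) -> continuous f -> elementary f.
Proof.
move=> lf cf; pose fL := GRing.isLinear.Build _ _ _ _ _ lf.
pose fl : {linear V -> R^o} := HB.pack f fL.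
exact: (@elementary_linear R V fl).
Qed.

Lemma elementary_space i : elementary (fun q : X * R => q.1 0 i).
Proof.
apply: elementary_linear_fun => [k u v|q]; first by rewrite /= !mxE.
apply: (continuous_comp (f := fst) (g := fun v : X => v 0 i)).
  exact: cvg_fst.
exact: coord_continuous.
Qed.

Lemma elementary_time : elementary (fun q : X * R => q.2).
Proof. by apply: elementary_linear_fun => [k u v//|q]; exact: cvg_snd. Qed.

Lemma elementary_cutoff x r : elementary (fun q : X * R => cutoff x r q.1).
Proof.
apply: (@elementary_prod R (X * R)%type 'I_n (index_enum _) (fun i (q : X * R) =>
  unit_bump ((2 * r)^-1 * (q.1 0 i - x 0 i) + 2^-1))) => i.
apply: (@elementary_bump _ _ (fun q : X * R =>
  (2 * r)^-1 * (q.1 0 i - x 0 i) + 2^-1)).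
apply: (@elementary_affine _ _ _ _ (fun q : X * R => q.1 0 i - x 0 i)).
apply: elementaryD; first exact: elementary_space.
exact: (elementary_cst (- x 0 i)).
Qed.

Lemma elementary_window a b e : elementary (fun q : X * R => window a b e q.2).
Proof.
have H c : elementary (fun q : X * R => step (e^-1 * (q.2 - c))).
  apply: (@elementary_step _ _ (fun q : X * R => e^-1 * (q.2 - c))).
  apply/elementaryZ/elementaryD; first exact: elementary_time.
  exact: (elementary_cst (- c)).
rewrite (_ : (fun q => _) = fun q : X * R => step (e^-1 * (q.2 - a)) +
    -1 * step (e^-1 * (q.2 - b))).
  by apply: elementaryD => //; exact: elementaryZ.
by apply/funext => q; rewrite mulN1r.
Qed.

(** The factor [expR] turns the weak form of du/dt = J u - u into that of
    d(e^t u)/dt = e^t J u. *)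
Lemma elementary_test x r a b e : elementary
  (fun q : X * R => cutoff x r q.1 * (expR q.2 * window a b e q.2)).
Proof.
apply: elementaryM; first exact: elementary_cutoff.
apply: elementaryM; last exact: elementary_window.
exact: (elementary_expR elementary_time).
Qed.

Lemma test_neq0_cylinder x r a b e (q : T) : 0 < r -> 0 < e -> a <= b ->
  cutoff x r q.1 * (expR q.2 * window a b e q.2) != 0 ->
  cylinder x r a (b + e) q.
Proof.
move=> r0 e0 ab; rewrite !mulf_eq0 !negb_or => /and3P[cq _ wq]; split => /=.
  by move=> i; rewrite in_itv/=; exact: cutoff_neq0 cq i.
rewrite in_itv/=; apply/andP; split; apply: contraNT wq; rewrite -ltNge => /ltW tq.
  by rewrite window_le.
by rewrite window_ge.
Qed.

Lemma test_function_test (Q : set (X * R)) x r a b e : 0 < r -> 0 < e -> a <= b ->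
  cylinder x r a (b + e) `<=` Q ->
  test_function Q (fun q : X * R => cutoff x r q.1 * (expR q.2 * window a b e q.2)).
Proof.
move=> r0 e0 ab cQ.
have sc : support_in Q (fun q : X * R =>
    cutoff x r q.1 * (expR q.2 * window a b e q.2)) `<=` cylinder x r a (b + e).
  rewrite [X in _ `<=` X](closure_id _).1; last exact: closed_cylinder.
  by apply: closureS => q [_ /=]; exact: test_neq0_cylinder.
split.
- exact/elementary_smooth/elementary_test.
- move=> q nQ; apply/eqP; apply: contra_notT nQ => /test_neq0_cylinder H.
  by apply: cQ; exact: H.
- split; last exact: subset_trans cQ.
  apply: (subclosed_compact _ _ sc); first exact: closed_closure.
  exact: compact_cylinder.
Qed.

(** Only the last variable moves in the direction (0, 1), so the derivative is that
    of a function of one variable. *)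
Lemma derive_time (psi : X -> R) (G : R -> R) dG (p : X * R) :
  is_derive p.2 1 G dG ->
  'D_(0, 1) (fun q : X * R => psi q.1 * G q.2) p = psi p.1 * dG.
Proof.
move=> dGp; transitivity ('D_1 (psi p.1 *: (G : R -> R^o)) p.2).
  rewrite /derive; congr (lim _); apply: (f_equal (fun g : R -> R => g @ 0^')).
  by apply/funext => h /=; rewrite scaler0 add0r.
by have [_ ->] := is_deriveZ (psi p.1) dGp.
Qed.

End test_functions.

(** * Integrals of cylindrically supported functions *)

Lemma Rintegral_gt0 d (T : measurableType d) (R : realType)
    (m : {measure set T -> \bar R}) (Q D : set T) (f : T -> R) :
  measurable Q -> measurable D -> D `<=` Q -> (0 < m D)%E ->
  m.-integrable Q (EFin \o f) -> (forall p, Q p -> 0 <= f p) ->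
  (forall p, D p -> 0 < f p) -> 0 < \int[m]_(p in Q) f p.
Proof.
move=> mQ mD DQ mD0 intf f0 fD; rewrite lt_neqAle Rintegral_ge0// andbT eq_sym.
apply/eqP => I0; have mf := measurable_int _ intf.
have : (\int[m]_(p in Q) `|(EFin \o f) p| = 0)%E.
  rewrite -[RHS]/(0%:E) -I0 /Rintegral fineK; last exact: integrable_fin_num.
  by apply: eq_integral => p; rewrite inE /= => Qp; rewrite ger0_norm// f0.
move/(ae_eq_integral_abs _ mQ mf) => f0ae.
suff : m D = 0%E by move=> E; rewrite E ltxx in mD0.
apply: (measure_negligible mD); apply: negligibleS f0ae => p Dp /= H.
have := fD p Dp; have := H (DQ _ Dp) => -[->]; rewrite ltxx//.
Qed.

Section cylinder_integrals.
Context {R : realType} {n : nat}.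
Notation X := 'rV[R]_n.
Notation T := (X * measurableTypeR R)%type.
Notation leb := (lebesgue_rV R n \x @lebesgue_measure R)%E.
Implicit Types (x y : X) (r a b e t : R) (Q : set T).

(** All the integrals of the weak formulation are of this kind: the support of [h] is
    contained in a compact cylinder, which has finite measure. *)
Lemma integrable_cylinder Q (g h : T -> R) C x r a b : measurable Q ->
  measurable_fun Q g -> (forall p, Q p -> `|g p| <= C) ->
  continuous (h : X * R -> R) -> (forall p, ~ cylinder x r a b p -> h p = 0) ->
  leb.-integrable Q (EFin \o (fun p => g p * h p)).
Proof.
move=> mQ mg gC ch h0; set f := EFin \o _.
have mc := measurable_cylinder x r a b.
have fE : f = f \_ (cylinder x r a b).
  apply/funext => p; rewrite patchE; case: ifPn => //.
  by rewrite notin_setE /f/= => /h0 ->; rewrite mulr0.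
rewrite fE; apply/(integrable_restrict _ mc mQ).
apply: measurable_bounded_integrable.
- exact: measurableI.
- apply: le_lt_trans (leb_cylinder_lty x r a b).
  by apply: le_measure; rewrite ?inE//; exact: measurableI.
- apply: (measurable_funS mQ) => //.
  apply: measurable_funM => //; apply: measurable_funTS.
  exact: continuous_measurable_prod.
- have [M [_ HM]] : bounded_set ((h : X * R -> R) @` cylinder x r a b).
    apply/compact_bounded/continuous_compact; last exact: compact_cylinder.
    by apply: continuous_subspaceT => p; exact: ch.
  exists (`|C| * (`|M| + 1)); split; first exact: num_real.
  move=> N CN p [Qp cp] /=; apply: le_trans (ltW CN); rewrite normrM ler_pM//.
    by rewrite (le_trans (gC _ Qp))// ler_norm.
  by apply: (HM (`|M| + 1)); [rewrite (le_lt_trans (ler_norm _))// ltrDl|exists p].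
Qed.

(** Fubini and the fundamental theorem of calculus in time. This replaces the
    integration by parts of the terms that do not contain the solution. *)
Lemma Rintegral_time_derivative Q x r a b (H H' : R -> R) : 0 < r -> a < b ->
  measurable Q -> cylinder x r a b `<=` Q ->
  (forall t, is_derive t 1 H (H' t)) -> continuous H' ->
  (forall t, t \notin `[a, b] -> H' t = 0) -> H a = 0 -> H b = 0 ->
  \int[leb]_(p in Q) (cutoff x r p.1 * H' p.2) = 0.
Proof.
move=> r0 ab mQ cQ dH cH' H'0 Ha Hb.
set f : T -> R := fun p => cutoff x r p.1 * H' p.2.
have f0 p : ~ cylinder x r a b p -> f p = 0.
  move=> np; apply/eqP; apply: contra_notT np; rewrite mulf_eq0 negb_or.
  move=> /andP[cp Hp]; split => /= [i|].
    by rewrite in_itv/=; exact: cutoff_neq0 cp i.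
  by apply: contraNT Hp => /H'0 ->.
have -> : \int[leb]_(p in Q) f p = \int[leb]_p f p.
  rewrite Rintegral_mkcond; congr (Rintegral _ _ _); apply/funext => p.
  by rewrite patchE; case: ifPn => //; rewrite notin_setE => nQ; rewrite f0// => /cQ.
have cf : continuous (f : X * R -> R).
  move=> p; apply: cvgM.
    exact: (elementary_continuous (elementary_cutoff x r)).
  by apply: (continuous_comp (f := snd)); [exact: cvg_snd|exact: cH'].
have intf : leb.-integrable setT (EFin \o f).
  rewrite (_ : f = fun p => cst 1 p * f p); last first.
    by apply/funext => p; rewrite mul1r.
  apply: (@integrable_cylinder _ _ _ 1 x r a b) => //.
  by move=> p _; rewrite normr1.
rewrite /Rintegral -(integral12_prod_meas1 intf) integral0_eq//= => y _.
(* The inner integral, in time, is H b - H a = 0. *)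
have intH : (\int[lebesgue_measure]_t (H' t)%:E = 0)%E.
  rewrite (_ : (fun t => _) = (EFin \o H') \_ `[a, b]); last first.
    apply/funext => t; rewrite patchE; case: ifPn => //.
    by rewrite notin_setE/= => /negP/H'0 ->.
  rewrite -integral_mkcond (continuous_FTC2 (F := H))//.
  - by rewrite Ha Hb subee.
  - by apply: continuous_subspaceT => t; exact: cH'.
  - split=> [t _||]; first by have [] := dH t.
    + apply: cvg_at_right_filter; apply: differentiable_continuous.
      by apply/derivable1_diffP; have [] := dH a.
    + apply: cvg_at_left_filter; apply: differentiable_continuous.
      by apply/derivable1_diffP; have [] := dH b.
  - by move=> t _; rewrite derive1E; have [_ ->] := dH t.
have intH' : lebesgue_measure.-integrable setT (EFin \o H').
  rewrite (_ : EFin \o _ = (EFin \o H') \_ `[a, b]); last first.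
    apply/funext => t; rewrite patchE; case: ifPn => //.
    by rewrite notin_setE/= => /negP/H'0 ->.
  apply/(integrable_mkcond _ _).1; first exact: measurable_itv.
  apply: continuous_compact_integrable; first exact: segment_compact.
  by apply: continuous_subspaceT => t; exact: cH'.
rewrite /fubini_F /f /=; under eq_integral do rewrite EFinM.
by rewrite integralZl// intH mule0.
Qed.

End cylinder_integrals.

(** * The jump operator *)

Section jump.
Context {R : realType} {n : nat}.
Notation X := 'rV[R]_n.
Notation T := (X * measurableTypeR R)%type.
Notation leb := (lebesgue_rV R n \x @lebesgue_measure R)%E.
Variables (mu : X -> R).
Hypothesis mu_L1 : (lebesgue_rV R n).-integrable setT (EFin \o mu).
Hypothesis mu_ge0 : forall z, 0 <= mu z.
Hypothesis mu_int1 : \int[lebesgue_rV R n]_z mu z = 1.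
Variables (w : T -> R) (C : R).
Hypothesis mw : measurable_fun setT w.
Hypothesis wC : forall p, `|w p| <= C.

(** Used with [w] the extension of the solution by 0 outside its domain, the integral over
    the [z] that keep [x + z] in the domain becomes one over the whole space, whose
    integrand is a measurable function of (x, t, z). *)
Definition jump (p : T) : R :=
  \int[lebesgue_rV R n]_z (w (p.1 + z, p.2) * mu z).

Let mmu : measurable_fun setT mu.
Proof. by apply/measurable_EFinP; exact: measurable_int mu_L1. Qed.

Let joint (q : T * X) : R := w (q.1.1 + q.2, q.1.2) * mu q.2.

Let measurable_joint : measurable_fun setT joint.
Proof.
apply: measurable_funM; last exact: measurableT_comp.
apply: (measurableT_comp mw); apply: measurable_fun_pair; last first.
  exact: (measurableT_comp measurable_snd measurable_fst).
apply: measurable_rV => i; under eq_fun do rewrite mxE.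
apply: measurable_funD.
  apply: (measurableT_comp (measurable_coord i)).
  exact: (measurableT_comp measurable_fst measurable_fst).
exact: (measurableT_comp (measurable_coord i) measurable_snd).
Qed.

(** Tonelli applied to the positive and negative parts of the joint integrand. *)
Lemma measurable_jump : measurable_fun setT jump.
Proof.
have mE : measurable_fun setT (EFin \o joint) by exact/measurable_EFinP.
have mp := measurable_fun_fubini_tonelli_F (m2 := lebesgue_rV R n) _
  (measurable_funepos mE) (funepos_ge0 _).
have mn := measurable_fun_fubini_tonelli_F (m2 := lebesgue_rV R n) _
  (measurable_funeneg mE) (funeneg_ge0 _).
apply: (measurableT_comp (f := fine)); first exact: fine_measurable.
rewrite (_ : (fun p => _) = fun p =>
    (fubini_F (lebesgue_rV R n) (EFin \o joint)^\+ p -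
     fubini_F (lebesgue_rV R n) (EFin \o joint)^\- p)%E).
  exact: emeasurable_funB.
apply/funext => p.
rewrite [LHS]integralE /fubini_F; congr (_ - _)%E; apply: eq_integral => z _;
  by rewrite ?funeposE ?funenegE.
Qed.

Lemma integrable_jump p :
  (lebesgue_rV R n).-integrable setT
    (EFin \o (fun z => w (p.1 + z, p.2) * mu z)).
Proof.
apply: (@le_integrable _ _ _ _ _ _ _ (EFin \o (fun z => C * mu z))) => //.
- apply/measurable_EFinP.
  exact: (measurableT_comp measurable_joint (measurable_pair1 p)).
- move=> z _ /=; rewrite lee_fin !normrM ler_wpM2r//.
  by rewrite (le_trans (wC _))// ler_norm.
- rewrite (_ : EFin \o _ = (fun z => C%:E * (EFin \o mu) z)%E); last first.
    by apply/funext => z; rewrite /= EFinM.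
  exact: integrableZl.
Qed.

Lemma jump_norm_le p : `|jump p| <= C.
Proof.
have iC : (lebesgue_rV R n).-integrable setT (EFin \o (fun z => C * mu z)).
  rewrite (_ : EFin \o _ = (fun z => C%:E * (EFin \o mu) z)%E); last first.
    by apply/funext => z; rewrite /= EFinM.
  exact: integrableZl.
apply: (le_trans (le_normr_Rintegral _ (integrable_jump p))) => //.
rewrite -[leRHS]mulr1 -mu_int1 -RintegralZl//.
apply: le_Rintegral => //.
  by move: (integrable_jump p) => /integrable_norm.
by move=> z _ /=; rewrite normrM (ger0_norm (mu_ge0 z)) ler_wpM2r.
Qed.

(** [mu] has mass 1, and a nonpositive lower bound of a solution in its domain is also
    one of its extension by 0. *)
Lemma jump_ge c p : c <= 0 -> (forall z, c <= w (z, p.2)) -> c <= jump p.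
Proof.
move=> c0 cw; rewrite -[leLHS]mulr1 -mu_int1 -RintegralZl//.
apply: le_Rintegral => //; last by move=> z _; rewrite ler_wpM2r.
  rewrite (_ : EFin \o _ = (fun z => c%:E * (EFin \o mu) z)%E); last first.
    by apply/funext => z; rewrite /= EFinM.
  exact: integrableZl.
exact: integrable_jump.
Qed.

Lemma jump_ge_on c p (B : set X) : measurable B -> 0 <= c ->
  (forall z, 0 <= w (z, p.2)) -> (forall z, B z -> c <= w (p.1 + z, p.2)) ->
  c * \int[lebesgue_rV R n]_(z in B) mu z <= jump p.
Proof.
move=> mB c0 w0 cw.
have iB : (lebesgue_rV R n).-integrable setT (EFin \o (mu \_ B)).
  rewrite -restrict_EFin; apply/(integrable_mkcond _ mB).1.
  exact: integrableS mu_L1.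
rewrite Rintegral_mkcond -RintegralZl//; apply: le_Rintegral => //.
- rewrite (_ : EFin \o _ = (fun z => c%:E * (EFin \o (mu \_ B)) z)%E); last first.
    by apply/funext => z; rewrite /= EFinM.
  exact: integrableZl.
- exact: integrable_jump.
- move=> z _; rewrite patchE; case: ifPn => [/set_mem zB|_].
    by rewrite ler_wpM2r// cw.
  by rewrite mulr0 mulr_ge0.
Qed.

Lemma density_gt0 (B : set X) : measurable B -> (0 < density_measure mu B)%E ->
  0 < \int[lebesgue_rV R n]_(z in B) mu z.
Proof.
move=> mB B0; rewrite /Rintegral fine_gt0// B0/=.
have : (lebesgue_rV R n).-integrable B (EFin \o mu) by exact: integrableS mu_L1.
by move/(integrable_fin_num mB); rewrite ge0_fin_numE// integral_ge0// => z _; rewrite lee_fin.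
Qed.

End jump.

(** * The comparison principle *)

Section duhamel.
Context {R : realType} {n : nat}.
Notation X := 'rV[R]_n.
Notation T := (X * measurableTypeR R)%type.
Notation leb := (lebesgue_rV R n \x @lebesgue_measure R)%E.
Variables (Omega : set X) (mu : X -> R) (u : X * R -> R) (C : R).
Hypothesis Omega_open : open Omega.
Hypothesis mu_L1 : (lebesgue_rV R n).-integrable setT (EFin \o mu).
Hypothesis mu_ge0 : forall z, 0 <= mu z.
Hypothesis mu_int1 : \int[lebesgue_rV R n]_z mu z = 1.

Notation A := (closure Omega `*` `[0 : R, +oo[).
Notation Q := (Omega `*` `]0 : R, +oo[).

Hypothesis u_continuous : {within A, continuous u}.
Hypothesis u_bounded : forall p, A p -> `|u p| <= C.
Hypothesis u_eq : dt_distr_eq Q u (K0 mu Omega u).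

Definition extension : T -> R := u \_ Q.
Notation J := (jump mu extension).

Lemma domain_sub_closure : Q `<=` A.
Proof.
move=> [y t] [/= Oy]; rewrite in_itv/= andbT => t0.
by split; [exact: subset_closure|rewrite /= in_itv/= andbT ltW].
Qed.

Lemma open_domain : open (Q : set (X * R)).
Proof.
rewrite openE => -[y t] [/= Oy t0]; exists (Omega, `]0, +oo[%classic) => //=.
split; apply: open_nbhs_nbhs; split => //.
Qed.

Lemma measurable_domain : measurable (Q : set T).
Proof. by apply: open_measurable_rV_prod; exact: open_domain. Qed.

Lemma measurable_solution : measurable_fun (Q : set T) (u : T -> R).
Proof.
apply: (within_continuous_measurable u_continuous) domain_sub_closure.
exact: open_domain.
Qed.

Lemma measurable_extension : measurable_fun setT extension.
Proof.
exact: (measurable_restrictT _ measurable_domain).1 measurable_solution.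
Qed.

Lemma extension_in p : Q p -> extension p = u p.
Proof. by move=> Qp; rewrite /extension patchE mem_set. Qed.

Lemma extension_out p : ~ Q p -> extension p = 0.
Proof. by move=> Qp; rewrite /extension patchE memNset. Qed.

Lemma extension_bounded p : `|extension p| <= `|C|.
Proof.
have [Qp|nQp] := pselect (Q p).
  rewrite extension_in// (le_trans (u_bounded (domain_sub_closure Qp)))//.
  exact: ler_norm.
by rewrite extension_out// normr0.
Qed.

Lemma K0_jump p : Q p -> K0 mu Omega u p = J p - u p.
Proof.
move=> [/= Op tp]; rewrite /K0 /jump Rintegral_mkcond; congr (_ - _).
congr (Rintegral _ _ _); apply/funext => z; rewrite patchE; case: ifPn.
  by rewrite inE /= => Oz; rewrite extension_in.
by rewrite notin_setE/= => Oz; rewrite extension_out ?mul0r// => -[].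
Qed.

(** The comparison principle described at the top: Duhamel's formula as an inequality,
    extracted from the distributional equation by a single family of test functions. *)
Lemma duhamel_monotone (W : set X) (a0 : R) (P p : R -> R) :
  open W -> W `<=` Omega -> 0 <= a0 ->
  (forall t : R, is_derive t 1 P (p t)) -> continuous p ->
  (forall y t, W y -> a0 < t -> p t <= expR t * J (y, t)) ->
  forall x s t, W x -> a0 < s -> s < t ->
  expR s * u (x, s) - P s <= expR t * u (x, t) - P t.
Proof.
move=> oW WO a00 dP cp HJ x s t Wx s0 st; rewrite leNgt; apply/negP => Fst.
(* The constant [k] separates the two values, so that [G] changes sign between the
   times [s] and [t]. *)
pose k := ((expR s * u (x, s) - P s) + (expR t * u (x, t) - P t)) / 2.
pose G (q : T) := expR q.2 * u q - (P q.2 + k).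
have Gs : 0 < G (x, s) by rewrite /G /k/=; lra.
have Gt : G (x, t) < 0 by rewrite /G /k/=; lra.
have cP : continuous P.
  move=> z; apply: differentiable_continuous; apply/derivable1_diffP.
  by have [] := dP z.
have c_expR : continuous (fun q : X * R => expR q.2).
  by move=> q; apply: (continuous_comp (f := snd)); [exact: cvg_snd|exact: continuous_expR].
have cPk : continuous (fun q : X * R => P q.2 + k).
  move=> q; apply: cvgD; last exact: cvg_cst.
  by apply: (continuous_comp (f := snd)); [exact: cvg_snd|exact: cP].
have cG : {within A, continuous (G : X * R -> R)}.
  move=> q; apply: cvgB; last exact: (continuous_subspaceT cPk).
  by apply: cvgM; [exact: (continuous_subspaceT c_expR)|exact: u_continuous].
have AW y z : W y -> a0 < z -> A (y, z).
  move=> Wy z0; apply: domain_sub_closure; split=> /=; first exact: WO.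
  by rewrite in_itv/= andbT (le_lt_trans a00).
have [d1 d10 H1] := within_continuousP cG (AW _ _ Wx s0) Gs.
have [|d2 d20 H2] := within_continuousP (e := - G (x, t)) cG (AW _ _ Wx (lt_trans s0 st)).
  by rewrite oppr_gt0.
have /nbhs_ballP[d3 /= d30 H3] : nbhs x W by exact: open_nbhs_nbhs.
(* Small enough for the sign of [G] to be constant around both points, for the
   cylinder to stay in [W], and for the two bumps of [dwindow] to be disjoint. *)
pose d := Num.min (Num.min d1 d2) (Num.min d3 (t - s)).
have d0 : 0 < d by rewrite !lt_min d10 d20 d30 subr_gt0.
have dd1 : d <= d1 by rewrite !ge_min lexx.
have dd2 : d <= d2 by rewrite !ge_min lexx orbT.
have dd3 : d <= d3 by rewrite !ge_min lexx !orbT.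
have ddt : d <= t - s by rewrite !ge_min lexx !orbT.
have [e eE] : exists e, e = d / 2 by exists (d / 2).
have e0 : 0 < e by rewrite eE; lra.
pose cyl : set T := cylinder x e s (t + e).
have cylP q : cyl q -> [/\ ball x d q.1, s <= q.2 & q.2 <= t + e].
  move=> [/= H]; rewrite in_itv/= => /andP[-> ->]; split=> //.
  apply/rV_ballP => // i; have := H i; rewrite /= in_itv/= => /andP[? ?].
  by rewrite ltr_distlC; apply/andP; split; lra.
have cylW q : cyl q -> W q.1 /\ a0 < q.2.
  by move=> /cylP[qx sq _]; split; [apply/H3/(le_ball dd3)|exact: lt_le_trans sq].
have cylQ : cyl `<=` Q.
  move=> q /cylW[Wq aq]; split=> /=; first exact: WO.
  by rewrite in_itv/= andbT (le_lt_trans a00).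
have G_near_s q : cyl q -> q.2 <= s + e -> 0 < G q.
  move=> cq qs; have [bq sq tq] := cylP _ cq; have [Wq aq] := cylW _ cq.
  have Aq : A q by rewrite (surjective_pairing q); exact: AW.
  have : `|G (x, s) - G q| < G (x, s).
    apply: H1 => //; split; first exact: le_ball bq.
    by rewrite /ball/= ltr_distlC; apply/andP; split; lra.
  by rewrite ltr_norml => /andP[_]; lra.
have G_near_t q : cyl q -> t <= q.2 -> G q < 0.
  move=> cq qt; have [bq sq tq] := cylP _ cq; have [Wq aq] := cylW _ cq.
  have Aq : A q by rewrite (surjective_pairing q); exact: AW.
  have : `|G (x, t) - G q| < - G (x, t).
    apply: H2 => //; split; first exact: le_ball bq.
    by rewrite /ball/= ltr_distlC; apply/andP; split; lra.
  by rewrite ltr_norml => /andP[]; lra.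
pose psi := cutoff x e; pose th := window s t e; pose dth := dwindow s t e.
have sqe : s + e <= t by lra.
have th_out q : ~ cyl q -> psi q.1 * th q.2 = 0.
  move=> nq; apply/eqP; apply: contra_notT nq => Hq.
  apply: (@test_neq0_cylinder _ _ x e s t e q e0 e0 (ltW st)).
  by rewrite mulrCA mulf_neq0// gt_eqF// expR_gt0.
have dth_out q : ~ cyl q -> psi q.1 * dth q.2 = 0.
  move=> nq; apply/eqP; apply: contra_notT nq; rewrite mulf_eq0 negb_or.
  move=> /andP[cq tq]; split => /= [i|].
    by rewrite in_itv/=; exact: cutoff_neq0 cq i.
  by apply: contraNT tq => /(dwindow_eq0 e0 (ltW st)) E; rewrite /dth E.
have cpsi : continuous (fun q : X * R => psi q.1).
  exact: (elementary_continuous (elementary_cutoff x e)).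
have c2 (f : R -> R) : continuous f -> continuous (fun q : X * R => f q.2).
  by move=> cf q; apply: (continuous_comp (f := snd)); [exact: cvg_snd|exact: cf].
have cth : continuous th.
  move=> z; apply: differentiable_continuous; apply/derivable1_diffP.
  by have [] := is_derive_window s t e z.
have cdth : continuous dth by exact: continuous_dwindow.
pose h1 (f : R -> R) (q : T) := psi q.1 * th q.2 * f q.2.
pose h2 (f : R -> R) (q : T) := psi q.1 * dth q.2 * f q.2.
have ch1 f : continuous f -> continuous (h1 f : X * R -> R).
  by move=> cf q; apply: cvgM; [apply: cvgM; [exact: cpsi|exact: c2]|exact: c2].
have ch2 f : continuous f -> continuous (h2 f : X * R -> R).
  by move=> cf q; apply: cvgM; [apply: cvgM; [exact: cpsi|exact: c2]|exact: c2].
have int1 (g : T -> R) D f : measurable_fun (Q : set T) g ->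
    (forall q, Q q -> `|g q| <= D) -> continuous f ->
    leb.-integrable Q (EFin \o (fun q => g q * h1 f q)).
  move=> mg gD cf; apply: (integrable_cylinder measurable_domain mg gD (ch1 _ cf)).
  by move=> q /th_out; rewrite /h1 => ->; rewrite mul0r.
have int2 (g : T -> R) D f : measurable_fun (Q : set T) g ->
    (forall q, Q q -> `|g q| <= D) -> continuous f ->
    leb.-integrable Q (EFin \o (fun q => g q * h2 f q)).
  move=> mg gD cf; apply: (integrable_cylinder measurable_domain mg gD (ch2 _ cf)).
  by move=> q /dth_out; rewrite /h2 => ->; rewrite mul0r.
have uC q : Q q -> `|u q| <= C by move=> /domain_sub_closure/u_bounded.
have mJ : measurable_fun (Q : set T) J.
  by apply: measurable_funTS; apply: measurable_jump => //; exact: measurable_extension.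
have JC q : Q q -> `|J q| <= `|C|.
  move=> _; apply: jump_norm_le => //; first exact: measurable_extension.
  exact: extension_bounded.
have mQ := measurable_domain.
have one_le (q : T) : Q q -> `|cst (1 : R) q| <= 1 by rewrite normr1.
have int1u : leb.-integrable Q (EFin \o (fun q => u q * h1 expR q)).
  exact: int1 measurable_solution uC (@continuous_expR R).
have int2u : leb.-integrable Q (EFin \o (fun q => u q * h2 expR q)).
  exact: int2 measurable_solution uC (@continuous_expR R).
have int1J : leb.-integrable Q (EFin \o (fun q => J q * h1 expR q)).
  exact: int1 mJ JC (@continuous_expR R).
have int1p : leb.-integrable Q (EFin \o (fun q => cst 1 q * h1 p q)).
  exact: int1 one_le cp.
have cPk1 : continuous (fun z => P z + k).
  by move=> z; apply: cvgD; [exact: cP|exact: cvg_cst].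
have int2P : leb.-integrable Q (EFin \o (fun q => cst 1 q * h2 (fun z => P z + k) q)).
  exact: int2 one_le cPk1.
(* The terms in which the derivative falls on [expR] cancel the term - u of the
   equation. *)
have weak : \int[leb]_(q in Q) (u q * h2 expR q) = - \int[leb]_(q in Q) (J q * h1 expR q).
  have tphi := @test_function_test _ _ Q x e s t e e0 e0 (ltW st) cylQ.
  have := u_eq tphi.
  have -> : \int[leb]_(q in Q) (u q * 'D_(0, 1)
      (fun q => cutoff x e q.1 * (expR q.2 * window s t e q.2)) q) =
    \int[leb]_(q in Q) (u q * h1 expR q + u q * h2 expR q).
    apply: eq_Rintegral => q _.
    have dq : is_derive q.2 1 (fun z => expR z * window s t e z)
        (expR q.2 * dth q.2 + th q.2 * expR q.2).
      exact: (is_deriveM (is_derive_expR q.2) (is_derive_window s t e q.2)).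
    by rewrite (derive_time (cutoff x e) dq) /h1 /h2 /psi; ring.
  have -> : \int[leb]_(q in Q) (K0 mu Omega u q *
      (cutoff x e q.1 * (expR q.2 * window s t e q.2))) =
    \int[leb]_(q in Q) (J q * h1 expR q - u q * h1 expR q).
    apply: eq_Rintegral => q /[!inE] Qq.
    by rewrite K0_jump// /h1 /psi /th; ring.
  by rewrite RintegralD// RintegralB//; lra.
(* The time derivative of (P + k) th integrates to 0. *)
have zero : \int[leb]_(q in Q) (cst 1 q * h1 p q) +
    \int[leb]_(q in Q) (cst 1 q * h2 (fun z => P z + k) q) = 0.
  rewrite -RintegralD//.
  transitivity (\int[leb]_(q in Q)
      (cutoff x e q.1 * ((P q.2 + k) * dth q.2 + th q.2 * p q.2))).
    by apply: eq_Rintegral => q _; rewrite /h1 /h2 /psi /=; ring.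
  apply: (@Rintegral_time_derivative _ _ Q x e s (t + e)
    (fun z => (P z + k) * th z) (fun z => (P z + k) * dth z + th z * p z)).
  - exact: e0.
  - lra.
  - exact: mQ.
  - exact: cylQ.
  - move=> z; apply: (is_deriveM (f := fun z => P z + k)).
      have := is_deriveD (dP z) (@is_derive_cst R R^o R^o k z 1).
      by rewrite addr0.
    exact: is_derive_window.
  - move=> z; apply: cvgD; first by apply: cvgM; [exact: cPk1|exact: cdth].
    by apply: cvgM; [exact: cth|exact: cp].
  - move=> z nz; rewrite [dth z](dwindow_eq0 e0 (ltW st) nz) mulr0 add0r.
    move: nz; rewrite in_itv/= negb_and -!ltNge => /orP[] /ltW nz.
      by rewrite [th z](window_le e0 (ltW st) nz) mul0r.
    by rewrite [th z](window_ge e0 (ltW st) nz) mul0r.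
  - by rewrite [th s](window_le e0 (ltW st) (lexx s)) mulr0.
  - by rewrite [th _](window_ge e0 (ltW st) (lexx _)) mulr0.
have intG : \int[leb]_(q in Q) (G q * (psi q.1 * dth q.2)) =
    \int[leb]_(q in Q) (u q * h2 expR q) -
    \int[leb]_(q in Q) (cst 1 q * h2 (fun z => P z + k) q).
  rewrite -RintegralB//; apply: eq_Rintegral => q _.
  by rewrite /G /h2 /=; ring.
have lep : \int[leb]_(q in Q) (cst 1 q * h1 p q) <= \int[leb]_(q in Q) (J q * h1 expR q).
  apply: le_Rintegral => // q Qq.
  have [cq|ncq] := pselect (cyl q); last by rewrite /h1 th_out// !mul0r !mulr0.
  have [Wq aq] := cylW _ cq.
  rewrite /h1 /= mul1r mulrCA ler_wpM2l//.
    by rewrite mulr_ge0 ?cutoff_ge0// window_ge0// ltW.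
  by rewrite mulrC {2}(surjective_pairing q); exact: HJ.
have le0 (a b c : R) : b + c = 0 -> b <= a -> - a - c <= 0.
  by move=> bc ba; rewrite -opprD oppr_le0 -bc lerD2r.
have int_le0 : \int[leb]_(q in Q) (G q * (psi q.1 * dth q.2)) <= 0.
  by rewrite intG weak; exact: le0 zero lep.
have se : s < s + e by rewrite ltrDl.
suff : 0 < \int[leb]_(q in Q) (G q * (psi q.1 * dth q.2)).
  by rewrite ltNge int_le0.
have BQ : ball x e `*` `]s, s + e[ `<=` cyl.
  move=> [y z] [/= /(rV_ballP _ _ e0) xy]; rewrite in_itv/= => /andP[sz ze].
  split=> /= [i|]; rewrite in_itv/=.
    have := xy i; rewrite ltr_distlC => /andP[/ltW -> /ltW ->]//.
  by rewrite (ltW sz) (le_trans (ltW ze))// lerD2r ltW.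
apply: (@Rintegral_gt0 _ T R leb Q (ball x e `*` `]s, s + e[)).
- exact: mQ.
- by apply: measurableX; [exact: measurable_ball_rV|exact: measurable_itv].
- exact: subset_trans BQ cylQ.
- exact: leb_box_gt0 e0 se.
- have := integrableB mQ int2u int2P; congr (leb.-integrable Q _ : Prop).
  by apply/funext => q /=; rewrite -EFinB; congr EFin; rewrite /G /h2 /=; ring.
(* [G] and [dth] are both nonnegative after [s] and both nonpositive after [t]; in
   between, [dth] vanishes. *)
- move=> q _; have [cq|ncq] := pselect (cyl q); last by rewrite dth_out// mulr0.
  rewrite mulrCA mulr_ge0 ?cutoff_ge0//.
  have [qs|qs] := leP q.2 (s + e).
    rewrite mulr_ge0 ?(ltW (G_near_s _ cq qs))// dwindow_ge0//.
    exact: le_trans qs sqe.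
  have [tq|qt] := leP t q.2.
    rewrite mulr_le0 ?(ltW (G_near_t _ cq tq))// dwindow_le0//.
    exact: ltW.
  suff -> : dth q.2 = 0 by rewrite mulr0.
  apply/eqP; rewrite eq_le dwindow_le0//; last exact: ltW.
  by rewrite dwindow_ge0// ltW.
- move=> q Bq; have cq := BQ _ Bq; case: Bq => xq; rewrite /= in_itv/= => /andP[sq qe].
  rewrite mulr_gt0 ?(G_near_s _ cq (ltW qe))// mulr_gt0//.
    exact: cutoff_gt0.
  exact: dwindow_gt0.
Qed.

End duhamel.

(** * Nonnegativity and propagation of positivity *)

Section positivity.
Context {R : realType} {n : nat}.
Notation X := 'rV[R]_n.
Notation T := (X * measurableTypeR R)%type.
Variables (Omega : set X) (mu : X -> R) (u0 : X -> R) (u : X * R -> R) (C : R).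
Hypothesis Omega_open : open Omega.
Hypothesis mu_L1 : (lebesgue_rV R n).-integrable setT (EFin \o mu).
Hypothesis mu_ge0 : forall z, 0 <= mu z.
Hypothesis mu_int1 : \int[lebesgue_rV R n]_z mu z = 1.

Notation A := (closure Omega `*` `[0 : R, +oo[).
Notation Q := (Omega `*` `]0 : R, +oo[).

Hypothesis u_continuous : {within A, continuous u}.
Hypothesis C_ge0 : 0 <= C.
Hypothesis u_bounded : forall p, A p -> `|u p| <= C.
Hypothesis u_eq : dt_distr_eq Q u (K0 mu Omega u).
Hypothesis u0_ge0 : forall x, Omega x -> 0 <= u0 x.
Hypothesis u_init : forall x, Omega x -> u (x, 0) = u0 x.

Notation w := (extension Omega u).
Notation J := (jump mu w).

Let monotone := duhamel_monotone Omega_open mu_L1 mu_ge0 mu_int1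
  u_continuous u_bounded u_eq.
Let mw : measurable_fun setT w := measurable_extension Omega_open u_continuous.
Let wC : forall p, `|w p| <= `|C| := extension_bounded u_bounded.

Let in_Q x t : Omega x -> 0 < t -> Q (x, t).
Proof. by move=> Ox t0; split=> //=; rewrite in_itv/= t0. Qed.

Let in_A x t : closure Omega x -> 0 <= t -> A (x, t).
Proof. by move=> Ox t0; split=> //=; rewrite in_itv/= t0. Qed.

(** The equation holds only for t > 0; this links it with the initial datum. *)
Lemma initial_value_limit x e t : Omega x -> 0 < e -> 0 < t ->
  exists2 s, 0 < s < t & `|u0 x - u (x, s)| < e.
Proof.
move=> Ox e0 t0.
have [d d0 H] := within_continuousP u_continuous
  (in_A (subset_closure Ox) (lexx 0)) e0.
pose s := Num.min d t / 2.
have m0 : 0 < Num.min d t by rewrite lt_min d0 t0.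
have s0 : 0 < s by rewrite divr_gt0.
have sm : s < Num.min d t by rewrite /s ltr_pdivrMr// ltr_pMr// ltr1n.
move: (sm); rewrite lt_min => /andP[sd st].
exists s; first by rewrite s0 st.
rewrite -u_init//; apply: H; first by apply: in_A (ltW s0); exact: subset_closure.
by split; [exact: ballxx|rewrite /ball/= sub0r normrN gtr0_norm].
Qed.

(** Comparison with P(t) = - (c / 2) e^(2t), whose derivative - c e^(2t) is below e^t J u
    as soon as u >= - c e^t. The weight e^t in the bound makes the improvement factor
    1 / 2 independent of the length of the time interval. *)
Lemma lower_bound_halving c : 0 <= c ->
  (forall x t, Omega x -> 0 < t -> - c * expR t <= u (x, t)) ->
  forall x t, Omega x -> 0 < t -> - (c / 2) * expR t <= u (x, t).
Proof.
move=> c0 H x t Ox t0.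
pose P z : R := - (c / 2) * (expR z * expR z).
pose p z : R := - (c / 2) * (expR z * expR z + expR z * expR z).
have dP (z : R) : is_derive z 1 P (p z).
  exact: (is_deriveZ (- (c / 2)) (is_deriveM (is_derive_expR z) (is_derive_expR z))).
have cE : continuous (fun z : R => expR z * expR z).
  by move=> z; apply: cvgM; exact: continuous_expR.
have cp : continuous p.
  by move=> z; apply: cvgM; [exact: cvg_cst|apply: cvgD; exact: cE].
have HJ y z : Omega y -> 0 < z -> p z <= expR z * J (y, z).
  move=> Oy z0; have -> : p z = expR z * (- c * expR z) by rewrite /p; field.
  rewrite ler_pM2l ?expR_gt0//; apply: (jump_ge mu_L1 mu_ge0 mu_int1 mw wC) => //.
    by rewrite mulNr oppr_le0 mulr_ge0// expR_ge0.
  move=> v /=; have [Qv|nQv] := pselect (Q (v, z)).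
    by rewrite extension_in//; case: Qv => /= Ov _; exact: H.
  by rewrite extension_out// mulNr oppr_le0 mulr_ge0// expR_ge0.
have mono := monotone Omega_open (@subset_refl _ Omega) (lexx 0) dP cp HJ.
suff : 0 <= expR t * u (x, t) - P t.
  rewrite /P subr_ge0 mulrCA ler_pM2l ?expR_gt0//.
apply/ler_addgt0Pl => e e0.
have e0' : 0 < e * expR (- t) by rewrite mulr_gt0// expR_gt0.
have [s /andP[s0 st] us] := initial_value_limit Ox e0' t0.
rewrite -lerBlDl sub0r; apply: le_trans (mono x s t Ox s0 st).
have Ps : P s <= 0.
  by rewrite /P mulNr oppr_le0 mulr_ge0 ?divr_ge0// mulr_ge0 ?expR_ge0.
apply: (@le_trans _ _ (expR s * u (x, s))); last by rewrite lerBrDr gerDl.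
have us' : - (e * expR (- t)) <= u (x, s).
  by move: us; rewrite ltr_distl => /andP[_]; have := u0_ge0 Ox; lra.
apply: le_trans (ler_wpM2l (expR_ge0 s) us').
rewrite mulrN lerN2 mulrCA ler_piMr ?(ltW e0)// -expRD.
by rewrite -[leRHS]expR0 ler_expR; lra.
Qed.

Lemma nonnegativity x t : Omega x -> 0 < t -> 0 <= u (x, t).
Proof.
have H k : forall x t, Omega x -> 0 < t -> - (C / 2 ^+ k) * expR t <= u (x, t).
  elim: k => [y s Oy s0|k IH].
    have Cy := u_bounded (in_A (subset_closure Oy) (ltW s0)).
    apply: (@le_trans _ _ (- C)).
      rewrite expr0 divr1 mulNr lerN2 ler_peMr//.
      by rewrite -[leLHS]expR0 ler_expR ltW.
    by rewrite lerNl (le_trans _ Cy)// -normrN ler_norm.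
  rewrite exprS invfM mulrCA [X in - X]mulrC; apply: lower_bound_halving => //.
  by rewrite divr_ge0// exprn_ge0.
move=> Ox t0; apply/ler_addgt0Pl => e e0.
pose k := Num.bound (C * expR t / e).
have kP : C * expR t / e < 2 ^+ k.
  apply: (@lt_trans _ _ k%:R).
    by apply: archi_boundP; rewrite divr_ge0 ?mulr_ge0 ?expR_ge0// ltW.
  by rewrite -natrX ltr_nat ltn_expl.
rewrite -lerBlDl sub0r; apply: le_trans (H k x t Ox t0).
rewrite mulNr lerN2 mulrAC ler_pdivrMr ?exprn_gt0// [leRHS]mulrC -ler_pdivrMr//.
exact: ltW.
Qed.

Lemma extension_ge0 p : 0 <= w p.
Proof.
have [Qp|nQp] := pselect (Q p); last by rewrite extension_out.
rewrite extension_in//; case: p Qp => y z [/= Oy]; rewrite in_itv/= andbT.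
exact: nonnegativity.
Qed.

Lemma exp_solution_nondecreasing x s t : Omega x -> 0 < s -> s < t ->
  expR s * u (x, s) <= expR t * u (x, t).
Proof.
move=> Ox s0 st.
have HJ y (z : R) : Omega y -> 0 < z -> cst 0 z <= expR z * J (y, z).
  move=> Oy z0; rewrite mulr_ge0 ?expR_ge0//.
  by apply: (jump_ge mu_L1 mu_ge0 mu_int1 mw wC) => // v; exact: extension_ge0.
have c0 : continuous (cst 0 : R -> R) by move=> z; exact: cvg_cst.
have := monotone Omega_open (@subset_refl _ Omega) (lexx 0)
  (fun z => @is_derive_cst R R^o R^o 0 z 1) c0 HJ Ox s0 st.
by rewrite /cst !subr0.
Qed.

(** Fix the intermediate time a = t / 2. After it, e^t u stays above a constant near
    [x0] by monotonicity, so e^t J u stays above a constant [g] near [x]; hence e^t u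
    gains [g] per unit of time there. Comparison is made at the points [y] of [Omega]
    near [x], uniformly in [y], so that the bound survives the limit to a boundary
    point [x]. *)
Lemma positivity_spreads x0 x : Omega x0 -> (forall t, 0 < t -> 0 < u (x0, t)) ->
  measure_support (density_measure mu) (x0 - x) -> closure Omega x ->
  forall t, 0 < t -> 0 < u (x, t).
Proof.
move=> Ox0 ux0 supp Ox t t0.
pose a := t / 2; have a0 : 0 < a by rewrite divr_gt0.
have at_ : a < t by rewrite /a; lra.
pose c := u (x0, a) / 2; have c0 : 0 < c by rewrite divr_gt0// ux0.
have [d d0 Hd] := within_continuousP u_continuous
  (in_A (subset_closure Ox0) (ltW a0)) c0.
have /nbhs_ballP[d' /= d'0 Hd'] : nbhs x0 Omega by exact: open_nbhs_nbhs.
pose r := Num.min d d'; have r0 : 0 < r by rewrite lt_min d0 d'0.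
have rd : r <= d by rewrite ge_min lexx.
have rd' : r <= d' by rewrite ge_min lexx orbT.
have rO y : ball x0 r y -> Omega y by move=> /(le_ball rd'); exact: Hd'.
have u_low y z : ball x0 r y -> a < z -> c * expR (- z) <= u (y, z).
  move=> xy az; have Oy := rO _ xy.
  have uya : c <= u (y, a).
    have : `|u (x0, a) - u (y, a)| < c.
      apply: Hd; first exact: in_A (subset_closure Oy) (ltW a0).
      by split; [exact: le_ball xy|exact: ballxx].
    by rewrite ltr_distl /c => /andP[_]; lra.
  rewrite expRN ler_pdivrMr ?expR_gt0// [leRHS]mulrC.
  apply: le_trans (exp_solution_nondecreasing Oy a0 az).
  apply: (le_trans uya); rewrite ler_peMl ?(le_trans (ltW c0))//.
  by rewrite -[leLHS]expR0 ler_expR ltW.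
pose B : set X := ball (x0 - x) (r / 2).
have r20 : 0 < r / 2 by rewrite divr_gt0.
have mB : measurable B by exact: measurable_ball_rV.
have B0 : 0 < \int[lebesgue_rV R n]_(z in B) mu z.
  apply: density_gt0 => //; apply: supp; first exact: ball_open.
  exact: ballxx.
pose g := c * \int[lebesgue_rV R n]_(z in B) mu z.
have g0 : 0 < g by rewrite mulr_gt0.
pose W : set X := Omega `&` ball x (r / 2).
have oW : open W by apply: openI => //; exact: ball_open.
have HJ y z : W y -> a < z -> cst g z <= expR z * J (y, z).
  move=> [Oy xy] az.
  rewrite -ler_pdivrMl ?expR_gt0// -expRN /cst /g mulrA [_ * c]mulrC.
  apply: (jump_ge_on mu_L1 mu_ge0 mw wC mB).
  - by rewrite mulr_ge0 ?expR_ge0// ltW.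
  - by move=> v; exact: extension_ge0.
  - move=> v Bv /=.
    have yv : ball x0 r (y + v).
      apply/rV_ballP => // i; rewrite !mxE.
      have /(rV_ballP _ _ r20)/(_ i) := Bv; have /(rV_ballP _ _ r20)/(_ i) := xy.
      rewrite !mxE !ltr_norml => /andP[? ?] /andP[? ?].
      by apply/andP; split; lra.
    rewrite extension_in; last by apply: in_Q; [exact: rO|exact: lt_trans az].
    exact: u_low.
pose s := (a + t) / 2.
have as_ : a < s by rewrite /s; lra.
have st : s < t by rewrite /s; lra.
have dg (z : R) : is_derive z 1 (fun z => g * z) (cst g z).
  by have := is_deriveZ g (@is_derive_id R R^o z 1); rewrite /GRing.scale/= mulr1.
have cg : continuous (cst g : R -> R) by move=> z; exact: cvg_cst.
have mono := monotone oW (@subIsetl _ _ _) (ltW a0) dg cg HJ.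
pose k := g * (t - s) * expR (- t).
have k0 : 0 < k by rewrite /k pmulr_lgt0 ?expR_gt0// mulr_gt0// subr_gt0.
have uk y : W y -> k <= u (y, t).
  move=> Wy; have Oy : Omega y by case: Wy.
  rewrite /k expRN ler_pdivrMr ?expR_gt0//.
  have := mono y s t Wy as_ st.
  have : 0 <= expR s * u (y, s).
    by rewrite mulr_ge0 ?expR_ge0// nonnegativity// (lt_trans a0).
  by rewrite [u _ * _]mulrC; move: (_ * u _) (_ * u _) => ? ?; lra.
have [e e0 He] := within_continuousP u_continuous (in_A Ox (ltW t0)) k0.
have [y [Oy xy]] : Omega `&` ball x (Num.min e (r / 2)) !=set0.
  by apply: Ox; apply: nbhsx_ballx; rewrite lt_min e0 r20.
have Wy : W y by split => //; apply: le_ball xy; rewrite ge_min lexx orbT.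
have : `|u (x, t) - u (y, t)| < k.
  apply: He; first exact: in_A (subset_closure Oy) (ltW t0).
  by split; [apply: le_ball xy; rewrite ge_min lexx|exact: ballxx].
by rewrite ltr_distl => /andP[]; have := uk _ Wy; lra.
Qed.

End positivity.

(** The crude constant 1 / (n + 1) also covers n = 0
    and is below the optimal 1 / sqrt n. *)
Lemma euclid_norm_le_ball (R : realType) n (x y : 'rV[R]_n) (eta : R) :
  0 < eta -> ball x (eta / n.+1%:R) y -> euclid_norm (x - y) <= eta.
Proof.
move=> eta0 xy; have d0 : 0 < eta / n.+1%:R by rewrite divr_gt0// ltr0n.
rewrite -[leRHS]ger0_norm ?(ltW eta0)// -sqrtr_sqr ler_wsqrtr//.
apply: (@le_trans _ _ (\sum_(i < n) (eta / n.+1%:R) ^+ 2)).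
  apply: ler_sum => i _; rewrite !mxE -real_normK ?num_real// lerXn2r ?nnegrE ?(ltW d0)//.
  by apply/ltW; have /(rV_ballP _ _ d0) := xy; apply.
rewrite sumr_const card_ord expr_div_n -[leLHS]mulr_natr -mulrA ler_piMr ?sqr_ge0//.
rewrite mulrC ler_pdivrMr ?exprn_gt0 ?ltr0n// mul1r -natrX ler_nat.
by rewrite expnS expn1 (leq_trans (leqnSn n))// leq_pmull.
Qed.

Theorem theorem6p1 (R : realType) (n : nat) (n_gt0 : (0 < n)%N)
  (Omega : set 'rV[R]_n)
  (Omega_open : open Omega) (Omega_bounded : bounded_set Omega)
  (Omega_connected : connected Omega) (Omega_smooth : smooth_boundary Omega)
  (mu : 'rV[R]_n -> R)
  (mu_L1 : (lebesgue_rV R n).-integrable setT (EFin \o mu))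
  (mu_ge0 : forall z, 0 <= mu z)
  (mu_int1 : \int[lebesgue_rV R n]_z mu z = 1)
  (mu_supp : exists2 eta : R, 0 < eta &
     [set z | euclid_norm z <= eta] `<=` measure_support (density_measure mu))
  (u0 : 'rV[R]_n -> R)
  (u0_continuous : {within Omega, continuous u0})
  (u0_ge0 : forall x, Omega x -> 0 <= u0 x)
  (u0_neq0 : exists2 x, Omega x & u0 x != 0)
  (u0_compact : compactly_supported_in Omega u0)
  (u : 'rV[R]_n * R -> R)
  (u_Cb : bounded_continuous_on (closure Omega `*` `[0 : R, +oo[) u)
  (u_eq : dt_distr_eq (Omega `*` `]0 : R, +oo[) u (K0 mu Omega u))
  (u_init : forall x, Omega x -> u (x, 0) = u0 x) :
  forall x t, closure Omega x -> 0 < t -> 0 < u (x, t).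
Proof.
have [cu [M [_ HM]]] := u_Cb; pose C := `|M| + 1.
have C0 : 0 <= C by rewrite addr_ge0.
have uC p : (closure Omega `*` `[0 : R, +oo[) p -> `|u p| <= C.
  by move=> Ap; apply: HM => //; rewrite (le_lt_trans (ler_norm _))// ltrDl.
have [eta eta0 supp] := mu_supp; pose d := eta / n.+1%:R.
have d0 : 0 < d by rewrite divr_gt0// ltr0n.
have spread x0 x : Omega x0 -> (forall t, 0 < t -> 0 < u (x0, t)) ->
    ball x0 d x -> closure Omega x -> forall t, 0 < t -> 0 < u (x, t).
  move=> Ox0 ux0 xx0.
  apply: (positivity_spreads Omega_open mu_L1 mu_ge0 mu_int1 cu C0 uC u_eq
    u0_ge0 u_init Ox0 ux0).
  by apply: supp; exact: euclid_norm_le_ball xx0.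
pose P : set 'rV[R]_n := Omega `&` [set x | forall t, 0 < t -> 0 < u (x, t)].
have P_all : P = Omega.
  apply: Omega_connected.
  - have [x1 Ox1 ux1] := u0_neq0; exists x1; split => // t t0.
    have e0 : 0 < u0 x1 by rewrite lt0r ux1 u0_ge0.
    have [s /andP[s0 st] us] := initial_value_limit cu u_init Ox1 e0 t0.
    have us0 : 0 < u (x1, s) by move: us; rewrite ltr_distl => /andP[_]; lra.
    rewrite -(pmulr_rgt0 _ (expR_gt0 t)).
    apply: lt_le_trans (exp_solution_nondecreasing Omega_open mu_L1 mu_ge0
      mu_int1 cu C0 uC u_eq u0_ge0 u_init Ox1 s0 st).
    by rewrite mulr_gt0// expR_gt0.
  - exists (\bigcup_(x in P) ball x d).
      by apply: bigcup_open => x _; exact: ball_open.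
    apply/seteqP; split=> [x Px|x [Ox [x0 [Ox0 Px0] xx0]]].
      by split; [case: Px|exists x => //; exact: ballxx].
    by split => //; apply: (spread x0) => //; exact: subset_closure.
  - exists (closure P); first exact: closed_closure.
    apply/seteqP; split=> [x Px|x [Ox clPx]].
      by split; [case: Px|exact: subset_closure].
    have [x0 [[Ox0 Px0] xx0]] := clPx _ (nbhsx_ballx x d d0).
    by split => //; apply: (spread x0) => //; [exact: ball_sym|exact: subset_closure].
move=> x t clx t0.
have [x0 [Ox0 xx0]] := clx _ (nbhsx_ballx x d d0).
have [_ Px0] : P x0 by rewrite P_all.
by apply: (spread x0) => //; exact: ball_sym.
Qed.
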